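(* Let $X=c_0(\mathbb{Z})$ or $X=\ell^p(\mathbb{Z})$, $1\le p<\infty$. (1) There exists an invertible weakly mixing operator on $X$ which is not $\mathcal{F}_{\mathrm{pud}}$-transitive. (2) There exists an invertible topologically ergodic operator on $X$ which is not $\mathcal{F}^*_{\mathrm{ip}}$-transitive. (3) There exists an invertible topologically ergodic operator on $X$ which is not $\mathcal{F}_{\mathrm{ud1}}$-transitive. (4) There exists an invertible $\mathcal{F}_{\mathrm{ld1}}$-transitive operator on $X$ which is not topologically ergodic. (5) There exists an invertible $\mathcal{F}_{\mathrm{lbd1}}$-transitive operator on $X$ which is not strongly mixing. (6) There exists an invertible $\mathcal{F}^*_{\mathrm{ip}}$-transitive operator on $X$ which is not $\Delta^*$-transitive. (7) There exists an invertible $\Delta^*_{\mathrm{ip}}$-transitive operator on $X$ which is not $\mathcal{F}^*_{\mathrm{ip}}$-transitive.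
   Context: $\mathbb{N}_0$ is the set of non-negative integers. An operator on $X$ is a continuous linear self-map $T$ of $X$ (scalars $\mathbb{R}$ or $\mathbb{C}$); invertible means bijective with continuous inverse. For $U,V\subset X$, $N_T(U,V)=\{n\in\mathbb{N}_0: T^nU\cap V\ne\emptyset\}$. For an upward-hereditary collection $\mathcal{F}$ of subsets of $\mathbb{N}_0$, $T$ is $\mathcal{F}$-transitive if $N_T(U,V)\in\mathcal{F}$ for all non-empty open $U,V\subset X$. $T$ is weakly mixing if $N_{T\oplus T}(U,V)\neq\emptyset$ for all non-empty open $U,V\subset X\oplus X$; strongly mixing if $N_T(U,V)$ is cofinite for all non-empty open $U,V\subset X$; topologically ergodic if $N_T(U,V)$ is syndetic (has bounded gaps) for all non-empty open $U,V\subset X$. Upper and lower density of $A\subset\mathbb{N}_0$: $\overline{\mathrm{D}}(A)=\limsup_{n\to\infty}\frac{|A\cap[0,n-1]|}{n}$, $\underline{\mathrm{D}}(A)=\liminf_{n\to\infty}\frac{|A\cap[0,n-1]|}{n}$; lower Banach density: $\underline{\mathrm{BD}}(A)=\liminf_{n-m\to\infty}\frac{|A\cap[m,n-1]|}{n-m}$. Put $\mathcal{F}_{\mathrm{pud}}=\{A:\overline{\mathrm{D}}(A)>0\}$, $\mathcal{F}_{\mathrm{ud1}}=\{A:\overline{\mathrm{D}}(A)=1\}$, $\mathcal{F}_{\mathrm{ld1}}=\{A:\underline{\mathrm{D}}(A)=1\}$, $\mathcal{F}_{\mathrm{lbd1}}=\{A:\underline{\mathrm{BD}}(A)=1\}$.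 For a sequence $(x_n)_{n\in\mathbb{N}}$ in $\mathbb{N}_0$, $\operatorname{FS}((x_n)_n)=\{x_{i_1}+\dots+x_{i_m}: i_1<\dots<i_m,\ m\in\mathbb{N}\}$. $\mathcal{F}_{\mathrm{ip}}$ is the family of IP-sets, i.e. sets $A\subset\mathbb{N}_0$ containing $\operatorname{FS}((x_n)_n)$ for some sequence in $\mathbb{N}_0$ with infinitely many non-zero terms. For $F\subset\mathbb{N}_0$, $F-F=\{m-n:m,n\in F,\ m\ne n\}$. $\Delta_{\mathrm{ip}}$ is the collection of sets of the form $(F-F)\cap\mathbb{N}_0$ with $F\in\mathcal{F}_{\mathrm{ip}}$; $\Delta$ is the collection of sets $A\subset\mathbb{N}_0$ containing $(F-F)\cap\mathbb{N}_0$ for some infinite $F\subset\mathbb{N}_0$. For a collection $\mathcal{G}$, $\mathcal{G}^*=\{A\subset\mathbb{N}_0:A\cap B\neq\emptyset\text{ for all }B\in\mathcal{G}\}$; thus $\mathcal{F}^*_{\mathrm{ip}}=(\mathcal{F}_{\mathrm{ip}})^*$, $\Delta^*_{\mathrm{ip}}=(\Delta_{\mathrm{ip}})^*$. *)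

(* Defs.v *)
From HB Require Import structures.
From mathcomp Require Import all_boot all_order all_algebra.
From mathcomp Require Import complex ring.
From mathcomp Require Import all_classical all_reals all_analysis.

Set Implicit Arguments.
Unset Strict Implicit.
Unset Printing Implicit Defensive.

Import Order.TTheory GRing.Theory Num.Theory.
Import numFieldNormedType.Exports.

Local Open Scope classical_set_scope.
Local Open Scope ring_scope.

Inductive scalars := RealScalars | ComplexScalars.

Definition scalar_field (R : realType) (s : scalars) : numFieldType :=
  match s with RealScalars => R | ComplexScalars => R[i]%C end.

(* The norm of a normed module over K takes its values in K, so the real-valued
   formulas below go through the modulus K -> R and the inclusion R -> K. *)
Definition modulus (R : realType) (s : scalars) : scalar_field R s -> R :=
  match s return scalar_field R s -> R with
  | RealScalars => fun x => `|x|
  | ComplexScalars => fun z => complex.Re `|z|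
  end.

Definition of_real (R : realType) (s : scalars) : R -> scalar_field R s :=
  match s return R -> scalar_field R s with
  | RealScalars => fun x => x
  | ComplexScalars => fun x => x%:C%C
  end.
Arguments of_real R s x : clear implicits.

Section scalar_theory.
Variables (R : realType) (s : scalars).
Local Notation K := (scalar_field R s).

Lemma of_real_modulus (x : K) : of_real R s (modulus x) = `|x|.
Proof. by case: s x => //= x; rewrite normc_def. Qed.

Lemma ler_of_real (a b : R) : (of_real R s a <= of_real R s b) = (a <= b).
Proof. by case: s => //=; rewrite lecR. Qed.

Lemma of_realD (a b : R) : of_real R s (a + b) = of_real R s a + of_real R s b.
Proof. by case: s => //=; rewrite rmorphD. Qed.

Lemma of_realM (a b : R) : of_real R s (a * b) = of_real R s a * of_real R s b.
Proof. by case: s => //=; rewrite rmorphM. Qed.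

Lemma of_real0 : of_real R s 0 = 0.
Proof. by case: s. Qed.

Lemma of_real1 : of_real R s 1 = 1.
Proof. by case: s. Qed.

Lemma of_real_inj : injective (of_real R s).
Proof. by move=> a b ab; apply/eqP; rewrite eq_le -!ler_of_real ab lexx. Qed.

Lemma modulus_ge0 (x : K) : 0 <= modulus x.
Proof. by rewrite -ler_of_real of_real_modulus of_real0. Qed.

Lemma modulus0 : modulus (0 : K) = 0.
Proof. by apply: of_real_inj; rewrite of_real_modulus of_real0 normr0. Qed.

Lemma modulus_eq0 (x : K) : modulus x = 0 -> x = 0.
Proof. by move=> x0; apply/normr0_eq0; rewrite -of_real_modulus x0 of_real0. Qed.

Lemma modulusM (x y : K) : modulus (x * y) = modulus x * modulus y.
Proof.
by apply: of_real_inj; rewrite of_realM !of_real_modulus normrM.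
Qed.

Lemma ler_modulusD (x y : K) : modulus (x + y) <= modulus x + modulus y.
Proof. by rewrite -ler_of_real of_realD !of_real_modulus ler_normD. Qed.

End scalar_theory.

(* A normed space of two-sided scalar sequences, presented by the set of its
   elements and a real-valued norm on that set. *)
Record seq_norm (R : realType) (s : scalars) := SeqNorm {
  sn_dom : set (int -> scalar_field R s);
  sn_norm : (int -> scalar_field R s) -> R;
  sn_dom0 : sn_dom 0;
  sn_domD : forall x y, sn_dom x -> sn_dom y -> sn_dom (x + y);
  sn_domZ : forall a x, sn_dom x -> sn_dom (a *: x);
  sn_normD : forall x y, sn_dom x -> sn_dom y ->
    sn_norm (x + y) <= sn_norm x + sn_norm y;
  sn_normZ : forall a x, sn_dom x -> sn_norm (a *: x) = modulus a * sn_norm x;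
  sn_norm_eq0 : forall x, sn_dom x -> sn_norm x = 0 -> x = 0
}.

Section seq_space.
Variables (R : realType) (s : scalars) (E : seq_norm R s).
Local Notation K := (scalar_field R s).

Definition sn_pred : {pred int -> K} := [pred x | `[< sn_dom E x >]].

Lemma sn_predP x : reflect (sn_dom E x) (x \in sn_pred).
Proof. exact: asboolP. Qed.

Lemma sn_pred_submod : submod_closed sn_pred.
Proof.
split=> [|a x y /sn_predP Ex /sn_predP Ey]; apply/sn_predP.
  exact: sn_dom0.
by apply: sn_domD => //; exact: sn_domZ.
Qed.

HB.instance Definition _ :=
  GRing.isSubmodClosed.Build K (int -> K) sn_pred sn_pred_submod.

Record seq_space := SeqSpace {
  seq_val :> int -> K;
  seq_valP : seq_val \in sn_pred
}.

HB.instance Definition _ := [isSub for seq_val].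
HB.instance Definition _ := [Choice of seq_space by <:].
HB.instance Definition _ := [SubChoice_isSubLmodule of seq_space by <:].

Definition seq_space_norm (x : seq_space) : K := of_real R s (sn_norm E x).

Lemma seq_space_dom (x : seq_space) : sn_dom E x.
Proof. exact/sn_predP/seq_valP. Qed.

Lemma ler_seq_space_normD (x y : seq_space) :
  seq_space_norm (x + y) <= seq_space_norm x + seq_space_norm y.
Proof.
by rewrite /seq_space_norm -of_realD ler_of_real;
  exact: (sn_normD (seq_space_dom x) (seq_space_dom y)).
Qed.

Lemma seq_space_normZ (a : K) (x : seq_space) :
  seq_space_norm (a *: x) = `|a| * seq_space_norm x.
Proof.
rewrite /seq_space_norm -of_real_modulus -of_realM; congr of_real.
exact: (sn_normZ a (seq_space_dom x)).
Qed.

Lemma seq_space_norm_eq0 (x : seq_space) : seq_space_norm x = 0 -> x = 0.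
Proof.
rewrite /seq_space_norm -(of_real0 R s) => /of_real_inj x0.
exact/val_inj/(sn_norm_eq0 (seq_space_dom x)).
Qed.

HB.instance Definition _ := Lmodule_isNormed.Build K seq_space
  ler_seq_space_normD seq_space_normZ seq_space_norm_eq0.

End seq_space.

Section c0.
Variables (R : realType) (s : scalars).
Local Notation K := (scalar_field R s).
Implicit Types x y : int -> K.

Definition c0_dom : set (int -> K) :=
  [set x | forall e : R, 0 < e ->
     exists N : nat, forall k : int, (N <= `|k|)%N -> modulus (x k) < e].

Definition c0_norm x : R := sup [set modulus (x k) | k in [set: int]].

Lemma c0_bounded x : c0_dom x ->
  has_ubound [set modulus (x k) | k in [set: int]].
Proof.
move=> /(_ 1 ltr01)[N xN].
exists (1 + \sum_(i < N.+1) (modulus (x i%:Z) + modulus (x (- i%:Z)))).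
move=> _ [k _ <-]; have [Nk|kN] := leqP N `|k|.
  rewrite (le_trans (ltW (xN _ Nk)))// lerDl.
  by apply: sumr_ge0 => i _; rewrite addr_ge0// modulus_ge0.
rewrite (bigD1 (Ordinal (leqW kN)))//= addrCA -[leLHS]addr0 lerD//; last first.
  rewrite addr_ge0//; apply: sumr_ge0 => i _.
  by rewrite addr_ge0// modulus_ge0.
have [k0|k0] := lerP 0 k.
  by rewrite (gez0_abs k0) lerDl modulus_ge0.
by rewrite (ltz0_abs k0) opprK lerDr modulus_ge0.
Qed.

Lemma c0_norm_ub x k : c0_dom x -> modulus (x k) <= c0_norm x.
Proof. by move=> /c0_bounded xb; apply: ub_le_sup => //; exists k. Qed.

Lemma c0_norm_le x (M : R) : (forall k, modulus (x k) <= M) -> c0_norm x <= M.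
Proof.
move=> xM; apply: ge_sup; first by exists (modulus (x 0)), 0.
by move=> _ [k _ <-].
Qed.

Lemma c0_dom0 : c0_dom 0.
Proof. by move=> e e0; exists 0%N => k _; rewrite modulus0. Qed.

Lemma c0_domD x y : c0_dom x -> c0_dom y -> c0_dom (x + y).
Proof.
move=> xc yc e e0; have e2 : 0 < e / 2 by rewrite divr_gt0.
have [[N xN] [M yM]] := (xc _ e2, yc _ e2).
exists (maxn N M) => k; rewrite geq_max => /andP[/xN xk /yM yk].
rewrite (le_lt_trans (ler_modulusD _ _))// [ltRHS](splitr e).
exact: ltrD.
Qed.

Lemma c0_domZ a x : c0_dom x -> c0_dom (a *: x).
Proof.
move=> xc e e0; have a1 : 0 < modulus a + 1.
  by rewrite ltr_wpDl// modulus_ge0.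
have [N xN] := xc _ (divr_gt0 e0 a1); exists N => k /xN.
rewrite ltr_pdivlMr// => xk; rewrite [_ k]/= modulusM.
by rewrite (le_lt_trans _ xk)// mulrC ler_wpM2l ?modulus_ge0// lerDl.
Qed.

Lemma c0_normD x y : c0_dom x -> c0_dom y ->
  c0_norm (x + y) <= c0_norm x + c0_norm y.
Proof.
move=> xc yc; apply: c0_norm_le => k.
by rewrite (le_trans (ler_modulusD _ _))// lerD// c0_norm_ub.
Qed.

Lemma c0_normZ a x : c0_dom x -> c0_norm (a *: x) = modulus a * c0_norm x.
Proof.
move=> xc; apply/eqP; rewrite eq_le; apply/andP; split.
  apply: c0_norm_le => k; rewrite [_ k]/= modulusM.
  by rewrite ler_wpM2l ?modulus_ge0// c0_norm_ub.
have [a0|a0] := eqVneq (modulus a) 0.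
  rewrite a0 mul0r (le_trans (modulus_ge0 ((a *: x) 0)))//.
  exact/c0_norm_ub/c0_domZ.
have {}a0 : 0 < modulus a by rewrite lt_def a0 modulus_ge0.
rewrite mulrC -ler_pdivlMr//; apply: c0_norm_le => k.
rewrite ler_pdivlMr// mulrC -modulusM.
exact: (c0_norm_ub k (c0_domZ a xc)).
Qed.

Lemma c0_norm_eq0 x : c0_dom x -> c0_norm x = 0 -> x = 0.
Proof.
move=> xc x0; apply/funext => k; apply: modulus_eq0; apply/eqP.
by rewrite eq_le modulus_ge0 andbT -x0 c0_norm_ub.
Qed.

Definition c0_seq_norm : seq_norm R s :=
  SeqNorm c0_dom0 c0_domD c0_domZ c0_normD c0_normZ c0_norm_eq0.

End c0.

Section lp.
Variables (R : realType) (s : scalars) (p : R).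
Local Notation K := (scalar_field R s).
Implicit Types x y : int -> K.

Definition lp_sum x : \bar R := \esum_(k in [set: int]) (modulus (x k) `^ p)%:E.

Definition lp_dom : set (int -> K) := [set x | (lp_sum x < +oo)%E].

Definition lp_norm x : R := fine (lp_sum x) `^ p^-1.

Hypothesis p1 : 1 <= p.

Let p_gt0 : 0 < p. Proof. exact: lt_le_trans p1. Qed.

Let p_neq0 : p != 0. Proof. by rewrite gt_eqF. Qed.

Lemma lp_sum_ge0 x : (0 <= lp_sum x)%E.
Proof. by apply: esum_ge0 => k _; rewrite lee_fin powR_ge0. Qed.

Lemma lp_sum_fineK x : lp_dom x -> (fine (lp_sum x))%:E = lp_sum x.
Proof. by move=> xl; rewrite fineK// ge0_fin_numE// lp_sum_ge0. Qed.

Lemma esumZ_le (c : R) (a : int -> \bar R) : 0 <= c -> (forall k, 0 <= a k)%E ->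
  (\esum_(k in [set: int]) (c%:E * a k) <= c%:E * \esum_(k in [set: int]) a k)%E.
Proof.
move=> c0 a0; apply: ge_ereal_sup => _ [F fF <-].
rewrite -ge0_mule_fsumr// lee_wpmul2l ?lee_fin//.
by apply: ereal_sup_ubound; exists F.
Qed.

Lemma lp_sum0 : lp_sum 0 = 0%E.
Proof.
by apply: esum1 => k _; rewrite modulus0 powR0.
Qed.

Lemma lp_sumZ_le a x : (lp_sum (a *: x) <= (modulus a `^ p)%:E * lp_sum x)%E.
Proof.
apply: le_trans (esumZ_le _ _); rewrite ?powR_ge0//; last first.
  by move=> k; rewrite lee_fin powR_ge0.
apply: le_esum => k _; rewrite -EFinM lee_fin [_ k]/= modulusM.
by rewrite powRM ?modulus_ge0.
Qed.

Lemma lp_dom0 : lp_dom 0.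
Proof. by rewrite /lp_dom/= lp_sum0. Qed.

Lemma lp_domZ a x : lp_dom x -> lp_dom (a *: x).
Proof.
move=> xl; rewrite /lp_dom/= (le_lt_trans (lp_sumZ_le a x))//.
by rewrite -lp_sum_fineK// -EFinM ltry.
Qed.

Lemma powR_convex (a b A B : R) : 0 <= a -> 0 <= b -> 0 < A -> 0 < B ->
  (a + b) `^ p <= (A + B) `^ p *
    (A / (A + B) * (a / A) `^ p + B / (A + B) * (b / B) `^ p).
Proof.
move=> a0 b0 A0 B0; have AB0 : 0 < A + B by rewrite addr_gt0.
have t0 : 0 <= A / (A + B) by rewrite divr_ge0// ltW.
have t1 : A / (A + B) <= 1 by rewrite ler_pdivrMr// mul1r lerDl ltW.
have /= := @convex_powR R p p1 (Itv01 t0 t1) (a / A) (b / B).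
rewrite !inE/= !in_itv/= !andbT !divr_ge0 ?(ltW A0) ?(ltW B0)// => /(_ isT isT).
rewrite !convRE/= => cvx.
have -> : a + b = (A + B) * (A / (A + B) * (a / A) + (1 - A / (A + B)) * (b / B)).
  have : A != 0 by rewrite gt_eqF.
  have : B != 0 by rewrite gt_eqF.
  have : A + B != 0 by rewrite gt_eqF.
  by move=> ? ? ?; field; apply/and3P.
have -> : B / (A + B) = 1 - A / (A + B).
  by have ? : A + B != 0 by [rewrite gt_eqF]; field.
rewrite powRM ?(ltW AB0)//; last first.
  by rewrite addr_ge0// mulr_ge0 ?subr_ge0//= divr_ge0 ?(ltW A0) ?(ltW B0).
by rewrite ler_wpM2l ?powR_ge0.
Qed.

Lemma lp_sumD_le x y (A B : R) : 0 < A -> 0 < B ->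
  (lp_sum (x + y)%R <= ((A + B) `^ p)%:E *
    ((A / (A + B) * A^-1 `^ p)%:E * lp_sum x +
     (B / (A + B) * B^-1 `^ p)%:E * lp_sum y))%E.
Proof.
move=> A0 B0; have AB0 : 0 < A + B by rewrite addr_gt0.
have cA : 0 <= A / (A + B) * A^-1 `^ p.
  by rewrite mulr_ge0 ?powR_ge0// divr_ge0// ltW.
have cB : 0 <= B / (A + B) * B^-1 `^ p.
  by rewrite mulr_ge0 ?powR_ge0// divr_ge0// ltW.
have m0 (z : int -> K) k : (0 <= (modulus (z k) `^ p)%:E)%E.
  by rewrite lee_fin powR_ge0.
apply: (@le_trans _ _ (\esum_(k in [set: int]) (((A + B) `^ p)%:E *
    ((A / (A + B) * A^-1 `^ p)%:E * (modulus (x k) `^ p)%:E +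
     (B / (A + B) * B^-1 `^ p)%:E * (modulus (y k) `^ p)%:E)))%E).
  apply: le_esum => k _; rewrite -!EFinM lee_fin.
  apply: (@le_trans _ _ ((modulus (x k) + modulus (y k)) `^ p)).
    by rewrite ge0_ler_powR ?nnegrE ?addr_ge0 ?modulus_ge0 ?(ltW p_gt0)//
      ler_modulusD.
  apply: (le_trans (powR_convex _ _ A0 B0)); rewrite ?modulus_ge0//.
  rewrite (powRM p (modulus_ge0 (x k))) ?invr_ge0 ?(ltW A0)//.
  rewrite (powRM p (modulus_ge0 (y k))) ?invr_ge0 ?(ltW B0)//.
  by rewrite ler_wpM2l ?powR_ge0// [_ `^ p * A^-1 `^ p]mulrC
    [_ `^ p * B^-1 `^ p]mulrC !mulrA.
apply: le_trans (esumZ_le _ _) _; rewrite ?powR_ge0//.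
  by move=> k; rewrite adde_ge0// mule_ge0.
rewrite lee_wpmul2l ?lee_fin ?powR_ge0// esumD//; last 2 first.
- by move=> k _; rewrite mule_ge0.
- by move=> k _; rewrite mule_ge0.
by rewrite leeD// esumZ_le.
Qed.

Lemma lp_domD x y : lp_dom x -> lp_dom y -> lp_dom (x + y).
Proof.
move=> xl yl; rewrite /lp_dom/=.
apply: le_lt_trans (lp_sumD_le x y ltr01 ltr01) _.
by rewrite -(lp_sum_fineK xl) -(lp_sum_fineK yl) -!EFinM ltry.
Qed.

Lemma lp_norm_ge0 x : 0 <= lp_norm x.
Proof. exact: powR_ge0. Qed.

Lemma lp_norm_powR x : lp_dom x -> (lp_norm x `^ p)%:E = lp_sum x.
Proof.
move=> xl; rewrite /lp_norm -powRrM mulVf// powRr1 ?lp_sum_fineK//.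
by rewrite fine_ge0// lp_sum_ge0.
Qed.

Lemma lp_norm_le x (M : R) : 0 <= M -> (lp_sum x <= (M `^ p)%:E)%E ->
  lp_norm x <= M.
Proof.
move=> M0 xM; have xl : lp_dom x by rewrite /lp_dom/= (le_lt_trans xM)// ltry.
rewrite -[leRHS](powRr1 M0) -(divff p_neq0) powRrM ge0_ler_powR//.
- by rewrite invr_ge0 ltW.
- by rewrite nnegrE fine_ge0// lp_sum_ge0.
- by rewrite nnegrE powR_ge0.
- by rewrite -lee_fin lp_sum_fineK.
Qed.

Lemma lp_norm_eq0 x : lp_dom x -> lp_norm x = 0 -> x = 0.
Proof.
move=> xl x0; apply/funext => k; apply: modulus_eq0.
apply: (@powR_eq0_eq0 _ _ p); apply/eqP.
rewrite eq_le powR_ge0 andbT -lee_fin.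
have -> : 0%:E = lp_sum x by rewrite -lp_norm_powR// x0 powR0.
apply: esum_ge; exists [set k]; first by split.
by rewrite fsbig_set1.
Qed.

Lemma lp_normD x y : lp_dom x -> lp_dom y ->
  lp_norm (x + y) <= lp_norm x + lp_norm y.
Proof.
move=> xl yl; have [x0|x0] := eqVneq (lp_norm x) 0.
  by rewrite x0 (lp_norm_eq0 xl x0) !add0r.
have [y0|y0] := eqVneq (lp_norm y) 0.
  by rewrite y0 (lp_norm_eq0 yl y0) !addr0.
have A0 : 0 < lp_norm x by rewrite lt_def x0 lp_norm_ge0.
have B0 : 0 < lp_norm y by rewrite lt_def y0 lp_norm_ge0.
apply: lp_norm_le; first exact: addr_ge0 (lp_norm_ge0 x) (lp_norm_ge0 y).
apply: le_trans (lp_sumD_le x y A0 B0) _.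
rewrite -(lp_norm_powR xl) -(lp_norm_powR yl) -!EFinM lee_fin.
move: (lp_norm x) (lp_norm y) A0 B0 {x0 y0} => A B A0 B0.
have cancel_powR (C : R) : 0 < C -> C^-1 `^ p * C `^ p = 1.
  by move=> C0; rewrite -powRM ?invr_ge0 ?(ltW C0)// mulVf ?gt_eqF// powR1.
rewrite -!mulrA !cancel_powR// !mulr1 -mulrDl.
by rewrite divff ?mulr1// gt_eqF// addr_gt0.
Qed.

Lemma lp_normZ_le a x : lp_dom x -> lp_norm (a *: x) <= modulus a * lp_norm x.
Proof.
move=> xl; apply: lp_norm_le; first exact: mulr_ge0 (modulus_ge0 a) (lp_norm_ge0 x).
rewrite (powRM p (modulus_ge0 a) (lp_norm_ge0 x)) EFinM lp_norm_powR//.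
exact: lp_sumZ_le.
Qed.

Lemma lp_normZ a x : lp_dom x -> lp_norm (a *: x) = modulus a * lp_norm x.
Proof.
move=> xl; apply/eqP; rewrite eq_le lp_normZ_le//=.
have [->|a0] := eqVneq a 0; first by rewrite modulus0 mul0r lp_norm_ge0.
have m0 : 0 < modulus a.
  by rewrite lt_def modulus_ge0 andbT; apply: contra_neq a0 => /modulus_eq0.
have aV : modulus a^-1 = (modulus a)^-1.
  apply: (mulfI (negbT (gt_eqF m0))); rewrite -modulusM (divff a0) divff ?gt_eqF//.
  by apply: (@of_real_inj R s); rewrite of_real_modulus normr1 of_real1.
rewrite mulrC -ler_pdivlMr// mulrC -aV.
by rewrite -{1}(scalerK a0 x) lp_normZ_le//; exact: lp_domZ.
Qed.

Definition lp_seq_norm : seq_norm R s :=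
  SeqNorm lp_dom0 lp_domD lp_domZ lp_normD lp_normZ lp_norm_eq0.

End lp.

Inductive space_index (R : realType) :=
  | C0
  | Lp (p : R) of 1 <= p.

Definition space_norm (R : realType) (s : scalars) (i : space_index R) :
    seq_norm R s :=
  match i with
  | C0 => c0_seq_norm R s
  | Lp p p1 => lp_seq_norm s p1
  end.

(* c_0(Z) for i = C0 and l^p(Z) for i = Lp p _, over R or R[i]. *)
Definition sequence_space (R : realType) (s : scalars) (i : space_index R) :
    normedModType (scalar_field R s) :=
  seq_space (space_norm s i).

Section dynamics.
Variable X : topologicalType.
Implicit Types (T : X -> X) (U V : set X).

Definition return_set T U V : set nat :=
  [set n | (iter n T @` U) `&` V !=set0].

Definition family_transitive (F : set (set nat)) T :=
  forall U V, open U -> open V -> U !=set0 -> V !=set0 -> F (return_set T U V).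

End dynamics.

Definition syndetic (A : set nat) :=
  exists M : nat, forall n : nat, exists2 k : nat, (n <= k <= n + M)%N & A k.

Definition strongly_mixing (X : topologicalType) (T : X -> X) :=
  family_transitive [set A | finite_set (~` A)] T.

Definition topologically_ergodic (X : topologicalType) (T : X -> X) :=
  family_transitive [set A | syndetic A] T.

Definition direct_sum (X : Type) (T : X -> X) (x : X * X) : X * X :=
  (T x.1, T x.2).

Definition weakly_mixing (X : topologicalType) (T : X -> X) :=
  forall U V : set (X * X), open U -> open V -> U !=set0 -> V !=set0 ->
    return_set (direct_sum T) U V !=set0.

Definition invertible_operator (K : numDomainType) (X : normedModType K)
    (T : {linear X -> X}) :=
  continuous T /\ exists S : X -> X, [/\ cancel T S, cancel S T & continuous S].

Section densities.
Variable R : realType.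
Implicit Types A : set nat.

Definition count_in A (m n : nat) : nat :=
  (\sum_(m <= k < n) (k \in A))%N.

(* The term at n = 0 is 0 / 0 = 0, which does not affect the limits. *)
Definition upper_density A : \bar R :=
  limn_esup (fun n => ((count_in A 0 n)%:R / n%:R)%:E).

Definition lower_density A : \bar R :=
  limn_einf (fun n => ((count_in A 0 n)%:R / n%:R)%:E).

(* The filter on pairs (m, n) defining the limit n - m --> oo. *)
Definition long_intervals : set_system (nat * nat) :=
  [set P | exists L : nat, forall m n : nat, (m + L <= n)%N -> P (m, n)].

Definition lower_banach_density A : \bar R :=
  limf_einf (fun mn : nat * nat =>
    ((count_in A mn.1 mn.2)%:R / (mn.2 - mn.1)%N%:R)%:E) long_intervals.

Definition F_pud : set (set nat) := [set A | (0 < upper_density A)%E].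
Definition F_ud1 : set (set nat) := [set A | upper_density A = 1%E].
Definition F_ld1 : set (set nat) := [set A | lower_density A = 1%E].
Definition F_lbd1 : set (set nat) := [set A | lower_banach_density A = 1%E].

End densities.

Definition finite_sums (x : nat -> nat) : set nat :=
  [set n | exists2 r : seq nat, (r != [::]) && sorted ltn r &
     n = (\sum_(i <- r) x i)%N].

Definition F_ip : set (set nat) :=
  [set A | exists2 x : nat -> nat, infinite_set [set n | x n <> 0%N] &
     finite_sums x `<=` A].

Definition difference_set (F : set nat) : set nat :=
  [set d | exists m n : nat, [/\ F m, F n, m <> n & d%:Z = m%:Z - n%:Z]].

Definition Delta_ip : set (set nat) := [set difference_set F | F in F_ip].

Definition Delta : set (set nat) :=
  [set A | exists2 F : set nat, infinite_set F & difference_set F `<=` A].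

Definition star (G : set (set nat)) : set (set nat) :=
  [set A | forall B, G B -> A `&` B !=set0].

(* Main.v *)
(* Let d be the distance to a nonempty set P of naturals. The weighted shift
   (T x)_k = 2^(d|k+1| - d|k|) x_(k+1) is invertible because d is 1-Lipschitz, and
   T^n multiplies by 2^(d|k+n| - d|k|). For finitely supported x and y, both T^n x
   and T^-n y tend to 0 as d(n) grows, so N_T(U, V) contains {d >= M} for some M;
   conversely, for small balls U, V around e_0 and -e_0, N_T(U, V) avoids P.
   Hence T is F-transitive as soon as every {d >= M} is in F, and T is not
   F-transitive if the complement of P is not in F. Each item is then a choice of P:
   (1) the complement of the union of the [2^k, 2^k + k[;
   (2), (3) the complement of a union of blocks of period 8^(k+1) and length 2^k,
     which has positive lower density and contains an IP-set;
   (4) the union of the [2^k, 2^k + k[;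
   (5) the powers of 2;
   (6) the differences of powers of 4;
   (7) the naturals with all digits 0 or 1 in base 8, which contain an IP-set but
     no approximate three-term progression with a large gap. *)

Require Import Defs.
From HB Require Import structures.
From mathcomp Require Import all_boot all_order all_algebra.
From mathcomp Require Import complex zify ring lra.
From mathcomp Require Import all_classical all_reals all_analysis.

Set Implicit Arguments.
Unset Strict Implicit.
Unset Printing Implicit Defensive.

Import Order.TTheory GRing.Theory Num.Theory.
Import numFieldNormedType.Exports.

Local Open Scope classical_set_scope.
Local Open Scope ring_scope.

(** * Shift-invariant domination and tails in the sequence spaces *)

Section coordinates.
Variables (R : realType) (s : scalars).
Local Notation K := (scalar_field R s).
Implicit Types x y : int -> K.

Lemma c0_dominated_shift x y (C : R) (j : int) : c0_dom x -> 0 <= C ->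
  (forall k, modulus (y k) <= C * modulus (x (k + j))) ->
  c0_dom y /\ c0_norm y <= C * c0_norm x.
Proof.
move=> xd C0 yx; split; last first.
  apply: c0_norm_le => k; apply: (le_trans (yx k)).
  by rewrite ler_wpM2l// c0_norm_ub.
(* Dividing by C + 1 instead of C covers C = 0. *)
move=> e e0; have C1 : 0 < C + 1 by rewrite ltr_wpDl.
have [N xN] := xd _ (divr_gt0 e0 C1); exists (N + `|j|)%N => k kN.
have /xN : (N <= `|(k + j)%R|)%N by lia.
rewrite ltr_pdivlMr// mulrC; apply: le_lt_trans.
by rewrite (le_trans (yx k))// ler_wpM2r ?modulus_ge0// lerDl.
Qed.

Lemma esum_shift (a : int -> \bar R) (j : int) :
  (\esum_(k in [set: int]) a (k + j)%R = \esum_(k in [set: int]) a k)%E.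
Proof.
symmetry; apply: (@reindex_esum _ _ _ setT setT (fun k : int => k + j)).
split => //; first by move=> k l _ _ /addIr.
by move=> k _; exists (k - j) => //; rewrite subrK.
Qed.

Lemma lp_dominated_shift (p : R) x y (C : R) (j : int) : 1 <= p ->
  lp_dom p x -> 0 <= C ->
  (forall k, modulus (y k) <= C * modulus (x (k + j))) ->
  lp_dom p y /\ lp_norm p y <= C * lp_norm p x.
Proof.
move=> p1 xd C0 yx; have p0 : 0 <= p by apply: le_trans p1.
have yxp : (lp_sum p y <= (C `^ p)%:E * lp_sum p x)%E.
  rewrite /lp_sum -(esum_shift (fun k => (modulus (x k) `^ p)%:E) j).
  apply: le_trans (esumZ_le _ _); rewrite ?powR_ge0//; last first.
    by move=> k; rewrite lee_fin powR_ge0.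
  apply: le_esum => k _; rewrite -EFinM lee_fin -powRM ?modulus_ge0//.
  by rewrite ge0_ler_powR// nnegrE ?mulr_ge0 ?modulus_ge0.
split.
  by rewrite /lp_dom/= (le_lt_trans yxp)// -lp_sum_fineK// -EFinM ltry.
apply: lp_norm_le => //; first by rewrite mulr_ge0 ?lp_norm_ge0.
by rewrite powRM ?lp_norm_ge0// EFinM lp_norm_powR.
Qed.

Lemma lp_coord_le (p : R) x k : 1 <= p -> lp_dom p x ->
  modulus (x k) <= lp_norm p x.
Proof.
move=> p1 xd; have p0 : 0 < p by apply: lt_le_trans p1.
have : modulus (x k) `^ p <= lp_norm p x `^ p.
  rewrite -lee_fin lp_norm_powR//; apply: esum_ge; exists [set k] => //.
  by rewrite fsbig_set1.
by apply: contraTT; rewrite -!ltNge => ?; rewrite gt0_ltr_powR// nnegrE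
  ?modulus_ge0 ?lp_norm_ge0.
Qed.

Definition tail_seq (N : nat) x : int -> K :=
  fun k => if (N <= `|k|)%N then x k else 0.

Lemma c0_tail x (e : R) : c0_dom x -> 0 < e ->
  exists N, c0_norm (tail_seq N x) <= e.
Proof.
move=> xd e0; have [N xN] := xd e e0; exists N; apply: c0_norm_le => k.
by rewrite /tail_seq; case: ifPn => [/xN/ltW//|_]; rewrite modulus0 ltW.
Qed.

(** Some finite partial sum is within e^p of the whole p-sum. Its index set lies in some |k| < N, so
    less than e^p is left beyond. *)
Lemma lp_tail (p : R) x (e : R) : 1 <= p -> lp_dom p x -> 0 < e ->
  exists N, lp_norm p (tail_seq N x) <= e.
Proof.
move=> p1 xd e0; have p0 : 0 < p by apply: lt_le_trans p1.
pose a k : \bar R := (modulus (x k) `^ p)%:E.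
have a0 k : (0 <= a k)%E by rewrite lee_fin powR_ge0.
have afin : (\esum_(k in [set: int]) a k)%E \is a fin_num.
  by rewrite ge0_fin_numE ?lp_sum_ge0.
have ep : 0 < e `^ p by apply: powR_gt0.
have [_ [F [finF _] <-] aF] := ub_ereal_sup_adherent ep afin.
have [N FN] : exists N : nat, forall k, F k -> (`|k| < N)%N.
  have [b bF] := (finite_seqP F).1 finF.
  exists (\max_(k <- b) `|k|).+1%N => k; rewrite bF/= => kb.
  by rewrite ltnS; exact: (leq_bigmax_seq (F := fun k : int => `|k|%N)).
exists N; apply: lp_norm_le => //; first exact: ltW.
pose B := [set k : int | (`|k| < N)%N].
have FB : (\sum_(k \in F) a k <= \esum_(k in B) a k)%E.
  by apply: esum_ge; exists F.
have aT : (\esum_(k in [set: int]) a k =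
    \esum_(k in B) a k + lp_sum p (tail_seq N x))%E.
  rewrite (esumID B)// setTI; congr (_ + _)%E.
  rewrite setTI esum_mkcond; apply: eq_esum => k _; rewrite /tail_seq.
  have -> : (k \in ~` B) = (N <= `|k|)%N.
    rewrite leqNgt; apply/idP/idP => [|kN]; rewrite inE; first by move/negP.
    exact/negP.
  by case: ifP => // _; rewrite modulus0 powR0 ?gt_eqF.
move: aF FB; rewrite -/(esum _ a) => aF FB.
have := lt_le_trans aF FB.
have Bfin : (\esum_(k in B) a k)%E \is a fin_num.
  rewrite ge0_fin_numE ?esum_ge0//; apply: le_lt_trans xd.
  by rewrite [leRHS]aT leeDl ?lp_sum_ge0.
by rewrite aT lteBlDr// lteD2lE// => /ltW.
Qed.

Lemma lp_delta (p : R) : 1 <= p ->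
  lp_dom p (fun k : int => (k == 0)%:R : K).
Proof.
move=> p1; have p0 : 0 < p by apply: lt_le_trans p1.
pose a k := (modulus ((k == 0 :> int)%:R : K) `^ p)%:E.
pose D := [set 0 : int].
suff : (\esum_(k in [set: int]) a k < +oo)%E by [].
rewrite (_ : esum _ _ = \esum_(k in D) a k)%E; last first.
  rewrite [RHS]esum_mkcond; apply: eq_esum => k _.
  case: ifPn => //; rewrite notin_setE /D/= /a => /eqP/negbTE->.
  by rewrite modulus0 powR0// gt_eqF.
by rewrite esum_set1 ?ltry ?lee_fin ?powR_ge0.
Qed.

Variable i : space_index R.
Local Notation E := (space_norm s i).

(** Besides the norm axioms, this lemma and the next three are all that the study of the shifts uses
    of c_0 and l^p. With j = 0 and C = 1 it also handles truncations. *)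
Lemma dominated_shift x y (C : R) (j : int) : sn_dom E x -> 0 <= C ->
  (forall k, modulus (y k) <= C * modulus (x (k + j))) ->
  sn_dom E y /\ sn_norm E y <= C * sn_norm E x.
Proof.
by case: i => [|p p1]; [exact: c0_dominated_shift|exact: lp_dominated_shift].
Qed.

Lemma coord_le x k : sn_dom E x -> modulus (x k) <= sn_norm E x.
Proof.
by case: i => [|p p1] /= xd; [exact: c0_norm_ub|exact: lp_coord_le].
Qed.

Lemma norm_tail x (e : R) : sn_dom E x -> 0 < e ->
  exists N, sn_norm E (tail_seq N x) <= e.
Proof. by case: i => [|p p1]; [exact: c0_tail|exact: lp_tail]. Qed.

Lemma delta_dom : sn_dom E (fun k : int => (k == 0)%:R : K).
Proof.
case: i => [|p p1]; last exact: lp_delta.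
move=> e e0; exists 1%N => k k1; rewrite (_ : k == 0 = false) ?modulus0//.
by apply/negP => /eqP k0; move: k1; rewrite k0.
Qed.

End coordinates.

(** * Weighted shifts *)

Section weighted_shift.
Variables (R : realType) (s : scalars) (i : space_index R).
Local Notation K := (scalar_field R s).
Local Notation E := (space_norm s i).
Local Notation X := (sequence_space s i).
Implicit Types (x y z : X) (k j l : int).

Lemma of_realB (a b : R) : of_real R s (a - b) = of_real R s a - of_real R s b.
Proof. by case: s => //=; rewrite rmorphB. Qed.

Lemma ltr_of_real (a b : R) : (of_real R s a < of_real R s b) = (a < b).
Proof.
rewrite !lt_def (@ler_of_real R s); congr (~~ _ && _).
by apply/eqP/eqP => [/of_real_inj|->].
Qed.

Lemma modulus_of_real (a : R) : 0 <= a -> modulus (of_real R s a) = a.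
Proof.
move=> a0; apply: (@of_real_inj R s); rewrite of_real_modulus ger0_norm//.
by rewrite -(of_real0 R s) ler_of_real.
Qed.

Lemma modulusB_ge (a b : K) : modulus a - modulus (a - b) <= modulus b.
Proof.
rewrite -(@ler_of_real R s) of_realB !of_real_modulus lerBlDr.
by rewrite -[leLHS]/(`|a|) -{1}(subrK b a) addrC ler_normD.
Qed.

Lemma seq_normE x : `|x| = of_real R s (sn_norm E (x : int -> K)).
Proof. by []. Qed.

Lemma open_norm (U : set X) x : open U -> U x ->
  exists2 d : R, 0 < d & forall z, sn_norm E (z - x : X) < d -> U z.
Proof.
move=> Uo Ux; have /nbhs_normP[e /= e0 eU] : nbhs x U by apply: open_nbhs_nbhs.
have ee : of_real R s (modulus e) = e by rewrite of_real_modulus gtr0_norm.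
exists (modulus e); first by rewrite -ltr_of_real of_real0 ee.
move=> z; rewrite -ltr_of_real ee -[ltLHS]/(`|z - x|) => zx.
by apply: eU; rewrite /= distrC.
Qed.

Variable psi : nat -> nat.
Hypothesis psi_lip : forall n, (psi n.+1 <= (psi n).+1)%N /\ (psi n <= (psi n.+1).+1)%N.

Lemma psi_lip_add n d : (psi (n + d) <= psi n + d)%N /\ (psi n <= psi (n + d) + d)%N.
Proof.
elim: d => [|d IH]; first by rewrite !addn0.
by rewrite addnS; have := psi_lip (n + d); lia.
Qed.

Lemma psi_lip_abs k l : (psi `|k|%N <= psi `|l|%N + `|(k - l)%R|%N)%N.
Proof.
have [kl|lk] := leqP `|k|%N `|l|%N.
  have := psi_lip_add `|k|%N (`|l| - `|k|)%N; rewrite subnKC// => -[_].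
  by move/leq_trans; apply; rewrite leq_add2l; lia.
have := psi_lip_add `|l|%N (`|k| - `|l|)%N; rewrite (subnKC (ltnW lk)) => -[+ _].
by move/leq_trans; apply; rewrite leq_add2l; lia.
Qed.

(** The weight of the j-th power of the shift at coordinate k, as a telescoped product; [psi] stands
    for the distance to P. Allowing negative j treats the inverse on the same footing. *)
Definition ratio k j : R := 2 ^+ psi `|(k + j)%R|%N / 2 ^+ psi `|k|%N.

Lemma ratio_ge0 k j : 0 <= ratio k j.
Proof. by rewrite divr_ge0// exprn_ge0. Qed.

(** Two natural exponents give growth bounds (M = 0) and decay bounds (M large) at once. *)
Lemma ratio_le k j M N : (psi `|(k + j)%R|%N + M <= psi `|k|%N + N)%N ->
  ratio k j <= 2 ^+ N / 2 ^+ M.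
Proof.
move=> h; rewrite /ratio ler_pdivrMr ?exprn_gt0// [leRHS]mulrAC ler_pdivlMr ?exprn_gt0//.
by rewrite -!exprD ler_weXn2l ?ler1n// [leqRHS]addnC.
Qed.

Lemma ratioD k j l : ratio k j * ratio (k + j) l = ratio k (j + l).
Proof.
by rewrite /ratio addrA mulrC mulrA divfK// expf_neq0// pnatr_eq0.
Qed.

Lemma ratio0 k : ratio k 0 = 1.
Proof. by rewrite /ratio addr0 divff// expf_neq0// pnatr_eq0. Qed.

Definition shift_fun j (x : int -> K) : int -> K :=
  fun k => of_real R s (ratio k j) * x (k + j).

Lemma modulus_shift_fun j (x : int -> K) k :
  modulus (shift_fun j x k) = ratio k j * modulus (x (k + j)).
Proof. by rewrite modulusM modulus_of_real// ratio_ge0. Qed.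

Lemma shift_fun_bound j (x : int -> K) : sn_dom E x ->
  sn_dom E (shift_fun j x) /\
  sn_norm E (shift_fun j x) <= 2 ^+ `|j|%N * sn_norm E x.
Proof.
move=> xd; apply: (dominated_shift (j := j)) => //.
move=> k; rewrite modulus_shift_fun ler_wpM2r ?modulus_ge0//.
rewrite -[leRHS]divr1 -(expr0 2) ratio_le// addn0.
by have := psi_lip_abs (k + j) k; rewrite addrAC subrr add0r.
Qed.

Lemma shift_proof j x : shift_fun j x \in sn_pred E.
Proof. by apply/sn_predP; case: (shift_fun_bound j (seq_space_dom x)). Qed.

Definition shift j x : X := SeqSpace (shift_proof j x).

Lemma shift_linear j : linear (shift j).
Proof.
move=> a x y; apply/val_inj/funext => k.
rewrite /= /shift_fun/= -[RHS]/(a * (_ * _) + _ * _).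
by rewrite -[LHS]/(_ * (a * _ + _)) mulrDr mulrCA.
Qed.

HB.instance Definition _ j :=
  GRing.isLinear.Build K X X *:%R (shift j) (shift_linear j).

Lemma shiftE j x k : shift j x k = of_real R s (ratio k j) * x (k + j).
Proof. by []. Qed.

Lemma shift_norm j x : sn_norm E (shift j x) <= 2 ^+ `|j|%N * sn_norm E x.
Proof. by case: (shift_fun_bound j (seq_space_dom x)). Qed.

Lemma shift_continuous j : continuous (shift j).
Proof.
apply: bounded_linear_continuous; apply/linear_boundedP.
near=> r => x; apply: (@le_trans _ _ (of_real R s (2 ^+ `|j|%N) * `|x|)).
  by rewrite !seq_normE -of_realM (@ler_of_real R s) shift_norm.
rewrite ler_wpM2r//; near: r; apply: nbhs_pinfty_ge.
by apply: ger0_real; rewrite -(of_real0 R s) (@ler_of_real R s) exprn_ge0.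
Unshelve. all: by end_near.
Qed.

(** Because the weights telescope, the shifts form an action of the integers, which makes the powers
    and the inverse of [shift 1] explicit. *)
Lemma shiftD j l x : shift j (shift l x) = shift (j + l) x.
Proof.
apply/val_inj/funext => k; rewrite /= /shift_fun/= /shift_fun.
by rewrite mulrA -of_realM ratioD addrA.
Qed.

Lemma shift0 x : shift 0 x = x.
Proof.
by apply/val_inj/funext => k; rewrite /= /shift_fun ratio0 of_real1 mul1r addr0.
Qed.

Lemma iter_shift n x : iter n (shift 1) x = shift n%:Z x.
Proof. 
elim: n => [|n IH]; first by rewrite shift0.
by rewrite iterS IH (shiftD 1 n x) intS.
Qed.

Lemma shift_invertible : invertible_operator (shift 1).
Proof.
split; first exact: shift_continuous.
exists (shift (-1)); split; last exact: shift_continuous.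
- by move=> x; rewrite /= (shiftD (- 1) 1 x) addNr shift0.
- by move=> x; rewrite /= (shiftD 1 (- 1) x) subrr shift0.
Qed.

Lemma modulus1 : modulus (1 : K) = 1.
Proof. by rewrite -(of_real1 R s) modulus_of_real. Qed.

Lemma modulusN (a : K) : modulus (- a) = modulus a.
Proof. by apply: (@of_real_inj R s); rewrite !of_real_modulus normrN. Qed.

Lemma sn_norm_ge0 x : 0 <= sn_norm E x.
Proof. exact: le_trans (modulus_ge0 (x 0)) (coord_le 0 (seq_space_dom x)). Qed.

Lemma sn_norm_triangle x y : sn_norm E (x + y) <= sn_norm E x + sn_norm E y.
Proof. exact: (sn_normD (seq_space_dom x) (seq_space_dom y)). Qed.

Lemma tail_dom N x : sn_dom E (tail_seq N x).
Proof.
apply: (proj1 (dominated_shift (j := 0) (C := 1) (seq_space_dom x) _ _)) => // k.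
by rewrite addr0 mul1r /tail_seq; case: ifP => // _; rewrite modulus0 modulus_ge0.
Qed.

Definition tail N x : X := SeqSpace (introT (@sn_predP R s E _) (tail_dom N x)).

Lemma tail_le M N x : (M <= N)%N ->
  sn_norm E (tail N x) <= sn_norm E (tail M x).
Proof.
move=> MN; rewrite -[leRHS]mul1r.
apply: (proj2 (dominated_shift (j := 0) (C := 1) (tail_dom M x) _ _)) => // k.
rewrite addr0 mul1r /= /tail_seq; case: ifPn => Nk; last by rewrite modulus0 modulus_ge0.
by rewrite (leq_trans MN).
Qed.

(** Only coordinates with |k + j| < N contribute. There the Lipschitz property gives psi|k + j| <=
    psi 0 + N and psi|k| >= psi|j| - N. *)
Lemma shift_trunc_norm N x j :
  sn_norm E (shift j (x - tail N x)) <=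
    2 ^+ (psi 0 + N + N) / 2 ^+ psi `|j|%N * sn_norm E (x - tail N x).
Proof.
apply: (proj2 (dominated_shift (j := j) (seq_space_dom _) _ _)) => [|k].
  by rewrite divr_ge0// exprn_ge0.
rewrite modulus_shift_fun; have [kN|kN] := leqP N `|(k + j)%R|%N.
  rewrite (_ : _ (k + j) = 0) ?modulus0 ?mulr0//.
  by rewrite -[LHS]/(x _ - tail_seq N x _) /tail_seq kN subrr.
rewrite ler_wpM2r ?modulus_ge0// ratio_le//.
have := psi_lip_abs (k + j) 0; have := psi_lip_abs (- j) k.
rewrite abszN absz0 subr0 (_ : - j - k = - (k + j)) ?abszN; last by ring.
lia.
Qed.

Lemma return_set_shift (U V : set X) :
  open U -> open V -> U !=set0 -> V !=set0 ->
  exists M, forall n, (M <= psi n)%N -> return_set (shift 1) U V n.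
Proof.
move=> Uo Vo [x Ux] [y Vy].
have [d d0 xU] := open_norm Uo Ux; have [e e0 yV] := open_norm Vo Vy.
(* Each approximation below has two errors of size at most r, one from truncating and one from
   shifting, and 2r stays below d and e. *)
pose r := Num.min d e / 3.
have r0 : 0 < r by rewrite divr_gt0// lt_min d0.
have rd : r + r < d.
  have : Num.min d e <= d by rewrite ge_min lexx.
  by rewrite /r; move: (Num.min d e) r0; rewrite /r => m; lra.
have re : r + r < e.
  have : Num.min d e <= e by rewrite ge_min lexx orbT.
  by rewrite /r; move: (Num.min d e) r0; rewrite /r => m; lra.
have [N1 xN1] := norm_tail (seq_space_dom x) r0.
have [N2 yN2] := norm_tail (seq_space_dom y) r0.
pose N := maxn N1 N2.
have xN : sn_norm E (tail N x) <= r.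
  by apply: le_trans xN1; apply: (tail_le x (leq_maxl _ _)).
have yN : sn_norm E (tail N y) <= r.
  by apply: le_trans yN2; apply: (tail_le y (leq_maxr _ _)).
set u := x - tail N x; set v := y - tail N y.
pose B := 2 ^+ (psi 0 + N + N) * (sn_norm E u + sn_norm E v).
have B0 : 0 <= B.
  by rewrite mulr_ge0 ?exprn_ge0// addr_ge0// sn_norm_ge0.
have [M BM] : exists M : nat, B <= 2 ^+ M * r.
  have /archi_boundP := divr_ge0 B0 (ltW r0).
  set M := Num.bound _ => BM; exists M; rewrite -ler_pdivrMr//.
  apply: (le_trans (ltW BM)); rewrite -natrX ler_nat ltnW// ltn_expl//.
have small w j : sn_norm E (w - tail N w) <= sn_norm E u + sn_norm E v ->
    (M <= psi `|j|%N)%N -> sn_norm E (shift j (w - tail N w)) <= r.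
  move=> wB Mj; apply: (le_trans (shift_trunc_norm N w j)).
  rewrite mulrAC ler_pdivrMr ?exprn_gt0// mulrC.
  apply: (@le_trans _ _ B).
    by rewrite mulrC ler_wpM2l// exprn_ge0.
  apply: (le_trans BM); rewrite mulrC ler_wpM2l ?(ltW r0)//.
  by rewrite ler_weXn2l ?ler1n.
(* The point u + T^-n v is close to x, and its image T^n u + v is close to y. *)
exists M => n Mn; exists (shift n%:Z (u + shift (- n%:Z) v)); split.
  exists (u + shift (- n%:Z) v); last by rewrite iter_shift.
  apply: xU; apply: le_lt_trans rd.
  have -> : u + shift (- n%:Z) v - x = shift (- n%:Z) v + (- 1) *: tail N x.
    by rewrite scaleN1r /u addrAC (addrAC x) subrr add0r addrC.
  rewrite (le_trans (sn_norm_triangle _ _))// lerD//.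
    by rewrite small ?abszN// lerDr sn_norm_ge0.
  rewrite (sn_normZ _ (seq_space_dom (tail N x))).
  by rewrite modulusN modulus1 mul1r.
rewrite linearD /= (shiftD n%:Z (- n%:Z) v) subrr shift0.
apply: yV; apply: le_lt_trans re.
have -> : shift n%:Z u + v - y = shift n%:Z u + (- 1) *: tail N y.
  by rewrite scaleN1r /v -!addrA; congr (_ + _); rewrite addrCA subrr addr0.
rewrite (le_trans (sn_norm_triangle _ _))// lerD//.
  by rewrite small// lerDl sn_norm_ge0.
rewrite (sn_normZ _ (seq_space_dom (tail N y))).
by rewrite modulusN modulus1 mul1r.
Qed.

Lemma return_set_direct_sum (X' : topologicalType) (T : X' -> X')
    (U1 U2 V1 V2 : set X') n :
  return_set T U1 V1 n -> return_set T U2 V2 n ->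
  return_set (direct_sum T) (U1 `*` U2) (V1 `*` V2) n.
Proof.
move=> [_ [[x1 Ux1 <-] Vx1]] [_ [[x2 Ux2 <-] Vx2]].
exists (iter n T x1, iter n T x2); split => //.
exists (x1, x2) => //; elim: n {Vx1 Vx2} => //= n ->.
by [].
Qed.

(** After shrinking to rectangles, both return sets contain some {psi >= M}, so a single n with psi
    n above both thresholds serves the two factors. *)
Lemma weakly_mixing_shift : (forall M, exists n, (M <= psi n)%N) ->
  weakly_mixing (shift 1).
Proof.
move=> psi_unbounded U V Uo Vo [[x1 x2] Ux] [[y1 y2] Vy].
have rect (W : set (X * X)) (z1 z2 : X) : open W -> W (z1, z2) ->
    exists A B : set X, [/\ open A, open B, A z1, B z2 & A `*` B `<=` W].
  move=> Wo Wz; have [[A B] /= [Az Bz] ABW] : nbhs (z1, z2) W.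
    exact: open_nbhs_nbhs.
  exists A^°, B^°; split; [exact: open_interior|exact: open_interior| | |] => //.
  by move=> [a b] [/interior_subset ? /interior_subset ?]; apply: ABW.
have [A1 [A2 [A1o A2o A1x A2x AU]]] := rect _ _ _ Uo Ux.
have [B1 [B2 [B1o B2o B1x B2x BV]]] := rect _ _ _ Vo Vy.
have [M1 HM1] := return_set_shift A1o B1o (ex_intro _ x1 A1x) (ex_intro _ y1 B1x).
have [M2 HM2] := return_set_shift A2o B2o (ex_intro _ x2 A2x) (ex_intro _ y2 B2x).
have [n nM] := psi_unbounded (maxn M1 M2).
have [] := @return_set_direct_sum _ (shift 1) A1 A2 B1 B2 n.
- by apply: HM1; apply: leq_trans nM; apply: leq_maxl.
- by apply: HM2; apply: leq_trans nM; apply: leq_maxr.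
move=> z [[t At tz] Bz]; exists n, z; split; last exact: BV.
by exists t => //; apply: AU.
Qed.

Definition delta : X := SeqSpace (introT (@sn_predP R s E _) (delta_dom s i)).

Lemma deltaE k : delta k = (k == 0)%:R.
Proof. by []. Qed.

(** If z is near e_0, then |z_0| > 3/4. For n > 0 the coordinate -n of T^n z is 2^(psi 0 - psi n)
    z_0, which must be below 1/4 because -e_0 vanishes there; this forces psi n > psi 0. *)
Lemma return_set_delta : exists U V : set X,
  [/\ open U, open V, U !=set0, V !=set0 &
    forall n, return_set (shift 1) U V n -> (psi 0 < psi n)%N].
Proof.
have q0 : 0 < of_real R s 4^-1.
  by rewrite -(of_real0 R s) ltr_of_real invr_gt0.
pose U := ball delta (of_real R s 4^-1).
pose V := ball (- delta) (of_real R s 4^-1).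
exists U, V; split.
- exact: ball_open.
- exact: ball_open.
- by exists delta; apply: ballxx.
- by exists (- delta); apply: ballxx.
have ball_coord z w k : ball z (of_real R s 4^-1) w ->
    modulus (z k - w k) < 4^-1.
  rewrite -ball_normE /ball_/= => zw; apply: le_lt_trans.
    exact: (coord_le k (seq_space_dom (z - w))).
  by rewrite -ltr_of_real.
move=> n [_ [[z Uz <-]]]; rewrite iter_shift => Vz.
have z0 : 3 / 4 < modulus (z 0).
  have := ball_coord _ _ 0 Uz; have := modulusB_ge (delta 0) (z 0).
  by rewrite deltaE eqxx modulus1; lra.
have := ball_coord _ _ (- n%:Z) Vz.
rewrite shiftE addNr -[(- delta) _]/(- (delta _)) -opprD modulusN deltaE.
(* For n = 0 the balls are disjoint: z_0 would be within 1/4 of both 1 and -1. *)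
case: eqP => [n0|_].
  have -> : n = 0%N by lia.
  have := ball_coord _ _ 0 Uz; rewrite deltaE eqxx oppr0 ratio0 of_real1.
  rewrite mul1r => z1 z2; have := ler_modulusD (1 - z 0) (1 + z 0).
  rewrite addrACA [_ + z 0]addrC subrr addr0 (_ : 1 + 1 = of_real R s (1 + 1)).
    by rewrite modulus_of_real//; lra.
  by rewrite of_realD of_real1.
rewrite add0r modulusM modulus_of_real ?ratio_ge0// /ratio addNr absz0 abszN absz_nat.
move=> small; rewrite ltnNge; apply/negP => nle; move: small.
apply/negP; rewrite -leNgt; apply: (@le_trans _ _ (3 / 4)); first lra.
apply: (le_trans (ltW z0)); rewrite ler_peMl ?modulus_ge0//.
by rewrite ler_pdivlMr ?exprn_gt0// mul1r ler_weXn2l ?ler1n.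
Qed.

End weighted_shift.

(** * Distance to a set and the resulting operators *)

(** The condition d(n) >= M spelled out pointwise, so that the combinatorial arguments never have to
    mention [distance]. *)
Definition far (P : set nat) (M : nat) : set nat :=
  [set n | forall m, P m -> (n + M <= m)%N \/ (m + M <= n)%N].

Section distance.
Variables (P : set nat) (P0 : P !=set0).

(** With truncated subtraction, n - m + (m - n) is |n - m|. *)
Lemma distance_ex n : exists d, `[< exists2 m, P m & d = (n - m + (m - n))%N >].
Proof. by have [m Pm] := P0; exists (n - m + (m - n))%N; apply/asboolP; exists m. Qed.

Definition distance n := ex_minn (distance_ex n).

Lemma distanceP n : exists2 m, P m & distance n = (n - m + (m - n))%N.
Proof. by rewrite /distance; case: ex_minnP => d /asboolP. Qed.

Lemma distance_le n m : P m -> (distance n <= n - m + (m - n))%N.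
Proof.
by move=> Pm; rewrite /distance; case: ex_minnP => d _; apply; apply/asboolP; exists m.
Qed.

Lemma distance_lip n :
  (distance n.+1 <= (distance n).+1)%N /\ (distance n <= (distance n.+1).+1)%N.
Proof.
have [m /(distance_le n.+1) + dm] := distanceP n.
have [l /(distance_le n) + dl] := distanceP n.+1.
lia.
Qed.

Lemma far_distance M n : far P M n -> (M <= distance n)%N.
Proof. by have [m Pm ->] := distanceP n => /(_ m Pm) []; lia. Qed.

Lemma distance_gt0 n : (0 < distance n)%N -> ~ P n.
Proof. by move=> d0 /(distance_le n); lia. Qed.

End distance.

Definition upward_closed (F : set (set nat)) :=
  forall A B : set nat, A `<=` B -> F A -> F B.

Lemma exists_operator (R : realType) (s : scalars) (i : space_index R)
    (P : set nat) : P !=set0 ->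
  exists T : {linear sequence_space s i -> sequence_space s i},
  [/\ invertible_operator T,
      (forall M, far P M !=set0) -> weakly_mixing T,
      (forall F, upward_closed F -> (forall M, F (far P M)) ->
        family_transitive F T) &
      (forall F, upward_closed F -> ~ F (~` P) -> ~ family_transitive F T)].
Proof.
move=> P0; exists (@shift R s i _ (distance_lip P0) 1); split.
- exact: shift_invertible.
- move=> farP; apply: weakly_mixing_shift => M.
  by have [n /(far_distance P0) Mn] := farP M; exists n.
- move=> F Fup FP U V Uo Vo U0 V0.
  have [M HM] := return_set_shift (distance_lip P0) Uo Vo U0 V0.
  by apply: Fup (FP M) => n /(far_distance P0) /HM.
move=> F Fup nFP FT; apply: nFP.
have [U [V [Uo Vo U0 V0 UV]]] := return_set_delta s i (distance_lip P0).
apply: Fup (FT U V Uo Vo U0 V0) => n /UV d0.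
(* The shift yields d(0) < d(n), hence d(n) > 0, whether or not 0 lies in P. *)
exact: (distance_gt0 (leq_ltn_trans _ d0)).
Qed.

(** * Densities *)

Lemma syndetic_upward : upward_closed [set A | syndetic A].
Proof.
by move=> A B AB [M AM]; exists M => n; have [k nk /AB] := AM n; exists k.
Qed.

Lemma cofinite_upward : upward_closed [set A | finite_set (~` A)].
Proof. by move=> A B AB; apply: sub_finite_set; apply: subsetC. Qed.

Lemma star_upward G : upward_closed (star G).
Proof. by move=> A B AB AG C /AG[n [/AB Bn Cn]]; exists n. Qed.

Lemma count_in_le (A B : set nat) m n : A `<=` B ->
  (count_in A m n <= count_in B m n)%N.
Proof.
move=> AB; apply: leq_sum => k _; case: (boolP (k \in A)) => //.
by rewrite inE => /AB Bk; rewrite (mem_set Bk).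
Qed.

Lemma count_inC (A : set nat) m n : (count_in A m n + count_in (~` A) m n = n - m)%N.
Proof.
rewrite /count_in -big_split/= -[RHS]muln1 -sum_nat_const_nat.
by apply: eq_bigr => k _; rewrite in_setC; case: (k \in A).
Qed.

Section densities.
Variable R : realType.
Implicit Types A B : set nat.
Local Open Scope ereal_scope.

Lemma limf_esup_le (T : choiceType) (X : filteredType T) (f g : X -> \bar R)
    (F : set (set X)) : (forall x, f x <= g x) -> limf_esup f F <= limf_esup g F.
Proof.
move=> fg; apply: le_ereal_inf_tmp => _ [V FV <-].
apply: (@le_trans _ _ (ereal_sup (f @` V))).
  by apply: ereal_inf_lbound; exists V.
apply: ge_ereal_sup => _ [x Vx <-]; apply: (le_trans (fg x)).
by apply: ereal_sup_ubound; exists x.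
Qed.

(** Indexing by an interval lets ordinary densities, with left end 0, and the Banach density share
    the same estimates. *)
Definition frequency A (mn : nat * nat) : R :=
  ((count_in A mn.1 mn.2)%:R / (mn.2 - mn.1)%N%:R)%R.

Lemma frequency_le A B mn : A `<=` B -> (frequency A mn <= frequency B mn)%R.
Proof.
by move=> AB; rewrite /frequency ler_wpM2r ?invr_ge0// ler_nat count_in_le.
Qed.

Lemma frequency_le1 A mn : (frequency A mn <= 1)%R.
Proof.
rewrite /frequency; have [->|n0] := posnP (mn.2 - mn.1)%N.
  by rewrite invr0 mulr0.
by rewrite ler_pdivrMr ?ltr0n// mul1r ler_nat -(count_inC A) leq_addr.
Qed.

Lemma upper_densityE A :
  upper_density R A = limn_esup (fun n => (frequency A (0%N, n))%:E).
Proof. by congr limn_esup; apply/funext => n; rewrite /frequency/= subn0. Qed.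

Lemma lower_densityE A :
  lower_density R A = limn_einf (fun n => (frequency A (0%N, n))%:E).
Proof. by congr limn_einf; apply/funext => n; rewrite /frequency/= subn0. Qed.

Lemma upper_density_le A B : A `<=` B -> upper_density R A <= upper_density R B.
Proof.
by move=> AB; rewrite !upper_densityE; apply: limf_esup_le => n;
  rewrite lee_fin frequency_le.
Qed.

Lemma limf_einf_le (T : choiceType) (X : filteredType T) (f g : X -> \bar R)
    (F : set (set X)) : (forall x, f x <= g x) -> limf_einf f F <= limf_einf g F.
Proof.
by move=> fg; rewrite /limf_einf leeN2; apply: limf_esup_le => x; rewrite leeN2.
Qed.

Lemma upper_density_le_eventually A (c : R) N :
  (forall n, (N <= n)%N -> ((count_in A 0 n)%:R <= c * n%:R)%R) ->
  (0 <= c)%R -> upper_density R A <= c%:E.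
Proof.
move=> Ac c0; apply: (@le_trans _ _ (ereal_sup ((fun n =>
    ((count_in A 0 n)%:R / n%:R)%:E) @` [set n | (N <= n)%N]))).
  by apply: ereal_inf_lbound; exists [set n | (N <= n)%N] => //; exists N.
apply: ge_ereal_sup => _ [n /= Nn <-]; rewrite lee_fin.
have [->|n0] := posnP n; first by rewrite invr0 mulr0.
by rewrite ler_pdivrMr ?ltr0n// Ac.
Qed.

(** The lower limit is the supremum over V in F of the infimum of f on V. Non-emptiness of V bounds
    it by 1, and the superlevel sets bring it arbitrarily close to 1. *)
Lemma limf_einf_eq1 (T : choiceType) (X : filteredType T) (f : X -> R)
    (F : set (set X)) : ~ F set0 -> (forall x, f x <= 1)%R ->
  (forall K : nat, F [set x | (1 - K.+1%:R^-1 <= f x)%R]) ->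
  limf_einf (EFin \o f) F = 1.
Proof.
move=> F0 f1 fF; apply/eqP; rewrite eq_le limf_einfE; apply/andP; split.
  apply: ge_ereal_sup => _ [V FV <-].
  have /set0P[x Vx] : V != set0 by apply/eqP => V0; apply: F0; rewrite -V0.
  apply: (@le_trans _ _ (f x)%:E); last by rewrite lee_fin.
  by apply: ereal_inf_lbound; exists x.
apply/lee_addgt0Pr => e e0.
have [K Ke] : exists K : nat, (K.+1%:R^-1 <= e)%R.
  exists (Num.bound e^-1); rewrite -[leRHS]invrK lef_pV2 ?posrE ?invr_gt0 ?ltr0n//.
  apply: (le_trans (ltW (archi_boundP _))); first by rewrite invr_ge0 ltW.
  by rewrite ler_nat.
rewrite -leeBlDr//; apply: (@le_trans _ _ (1 - K.+1%:R^-1)%:E).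
  by rewrite lee_fin lerB.
apply: (@le_trans _ _ (ereal_inf ((EFin \o f) @` [set x | (1 - K.+1%:R^-1 <= f x)%R]))).
  by apply: le_ereal_inf_tmp => _ [x /= fx <-]; rewrite lee_fin.
by apply: ereal_sup_ubound; eexists; first exact: fF.
Qed.

Lemma frequency_ge A m n K : (m < n)%N ->
  (K.+1 * count_in (~` A) m n <= n - m)%N ->
  (1 - K.+1%:R^-1 <= frequency A (m, n))%R.
Proof.
move=> mn cA; have nm : (0 < (n - m)%N%:R :> R)%R by rewrite ltr0n subn_gt0.
rewrite /frequency/= ler_pdivlMr// -(count_inC A m n) natrD mulrBl mul1r.
rewrite lerBlDr lerD2l ler_pdivlMl ?ltr0n// -natrD -natrM ler_nat.
by rewrite count_inC.
Qed.

(** The hypothesis says that the complement has density zero, multiplied out so that the counting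
    can be done in the naturals. *)
Lemma lower_density1 A :
  (forall K, exists N, forall n, (N <= n)%N -> (K * count_in (~` A) 0 n <= n)%N) ->
  F_ld1 R A.
Proof.
move=> AK; rewrite /F_ld1/= lower_densityE; apply: limf_einf_eq1.
- by move=> [N _ /(_ N)]; apply; exact: leqnn.
- by move=> n; exact: frequency_le1.
move=> K; have [N HN] := AK K.+1; exists N.+1 => // n /= Nn.
by apply: frequency_ge; rewrite ?(leq_ltn_trans _ Nn)// subn0 HN// ltnW.
Qed.

Lemma lower_banach_density1 A :
  (forall K, exists N, forall m n, (m + N <= n)%N ->
    (K * count_in (~` A) m n <= n - m)%N) ->
  F_lbd1 R A.
Proof.
move=> AK; rewrite /F_lbd1/= /lower_banach_density.
apply: (limf_einf_eq1 (f := frequency A)).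
- by move=> [L /(_ 0%N L)]; apply.
- by move=> n; exact: frequency_le1.
move=> K; have [N HN] := AK K.+1; exists N.+1 => m n /= mn.
by apply: frequency_ge; [lia|apply: HN; lia].
Qed.

Lemma F_pud_upward : upward_closed (F_pud R).
Proof. by move=> A B AB /lt_le_trans; apply; exact: upper_density_le. Qed.

Lemma upper_density_le1 A : upper_density R A <= 1.
Proof.
apply: (@upper_density_le_eventually _ _ 0) => // n _.
by rewrite mul1r ler_nat -[leqRHS]subn0 -(count_inC A) leq_addr.
Qed.

Lemma F_ud1_upward : upward_closed (F_ud1 R).
Proof.
move=> A B AB; rewrite /F_ud1/= => A1; apply/eqP.
by rewrite eq_le upper_density_le1 -A1 upper_density_le.
Qed.

Lemma F_ld1_upward : upward_closed (F_ld1 R).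
Proof.
move=> A B AB; rewrite /F_ld1/= => A1; apply/eqP; rewrite eq_le; apply/andP; split.
  exact: le_trans (limn_einf_sup _) (upper_density_le1 B).
rewrite -A1 !lower_densityE; apply: limf_einf_le => n.
by rewrite lee_fin frequency_le.
Qed.

Lemma F_lbd1_upward : upward_closed (F_lbd1 R).
Proof.
move=> A B AB; rewrite /F_lbd1/= => A1; apply/eqP; rewrite eq_le; apply/andP; split.
  rewrite /lower_banach_density limf_einfE; apply: ge_ereal_sup => _ [V [L VL] <-].
  apply: (@le_trans _ _ (frequency B (0%N, L))%:E).
    by apply: ereal_inf_lbound; exists (0%N, L) => //; apply: VL.
  by rewrite lee_fin frequency_le1.
rewrite -A1; apply: limf_einf_le => n; rewrite lee_fin; exact: frequency_le.
Qed.

End densities.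

(** * Sets defined by powers of 2 and 8 *)

Lemma count_in_cover (A : set nat) (B : nat -> set nat) m n K :
  (forall x, (m <= x < n)%N -> A x -> exists2 k, (k < K)%N & B k x) ->
  (count_in A m n <= \sum_(k < K) count_in (B k) m n)%N.
Proof.
move=> AB; rewrite /count_in exchange_big/= big_nat_cond [leqRHS]big_nat_cond.
apply: leq_sum => x; rewrite andbT => mxn; case: (boolP (x \in A)) => //.
rewrite inE => /(AB _ mxn)[k kK Bkx].
by rewrite (bigD1 (Ordinal kK))//= (mem_set Bkx) leq_addr.
Qed.

Lemma count_in_interval (A : set nat) m n a w :
  (forall x, (m <= x < n)%N -> A x -> (a <= x < a + w)%N) ->
  (count_in A m n <= w)%N.
Proof.
move=> Aaw; rewrite /count_in -big_mkcond/= sum1_count -size_filter.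
rewrite -[leqRHS](size_iota a); apply: uniq_leq_size.
  by rewrite filter_uniq// iota_uniq.
move=> x; rewrite mem_filter mem_index_iota mem_iota => /andP[].
by rewrite inE => Ax /Aaw; apply.
Qed.

(** The factor 4 is attained at L = 4; from there on (L + 1)^3 <= 2 L^3. *)
Lemma cube_le_expn L : (L ^ 3 <= 4 * 2 ^ L)%N.
Proof.
have [|] := leqP L 4; first by case: L => [|[|[|[|[|]]]]].
elim: L => // L IH; rewrite ltnS leq_eqVlt => /predU1P[<- //|/[dup] L4 /IH].
rewrite (expnS 2 L) => h; nia.
Qed.

(** The product bounds the number of points near powers of 2 below n: about L + 1 windows of width L
    + 2M, with L logarithmic in n. *)
Lemma log_square_negligible K M : exists N, forall n, (N <= n)%N ->
  (K * ((trunc_log 2 (n + 2 * M) + 1) * (trunc_log 2 (n + 2 * M) + 2 * M)) <= n)%N.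
Proof.
(* For L > L0 this gives 8K(4M + 2)L^2 <= L^3 <= 4(n + 2M); the factor 8 in place of 4 absorbs the
   2M. The choice of N settles L <= L0. *)
pose L0 := (8 * K * (4 * M + 2) + 1)%N.
exists (K * ((L0 + 1) * (L0 + 2 * M)) + 2 * M + 1)%N => n Nn; set L := trunc_log 2 _.
have Ln : (2 ^ L <= n + 2 * M)%N by apply: trunc_logP => //; lia.
have [LL0|L0L] := leqP L L0.
  apply: (@leq_trans (K * ((L0 + 1) * (L0 + 2 * M)))); last by lia.
  by rewrite leq_mul// leq_mul// leq_add.
have h3 := cube_le_expn L.
have h1 : ((L + 1) * (L + 2 * M) <= (4 * M + 2) * (L * L))%N.
  apply: (@leq_trans ((2 * L) * ((2 * M + 1) * L))); last by nia.
  by apply: leq_mul; nia.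
have h2 : (8 * (K * ((4 * M + 2) * (L * L))) <= L ^ 3)%N.
  rewrite (_ : L ^ 3 = L * (L * L))%N; last by rewrite !expnS expn0 muln1.
  apply: (@leq_trans ((8 * K * (4 * M + 2)) * (L * L))); first by rewrite !mulnA.
  by rewrite leq_mul//; rewrite /L0 in L0L; lia.
have h4 : (K * ((L + 1) * (L + 2 * M)) <= K * ((4 * M + 2) * (L * L)))%N.
  by rewrite leq_mul.
lia.
Qed.

Definition near_power (w : nat -> nat) (M : nat) : set nat :=
  [set n | exists k, (2 ^ k < n + M)%N /\ (n < 2 ^ k + w k + M)%N].

(** A window that meets [0, n) has 2^k < n + 2M, hence k <= L, and its width is at most L + 2M. *)
Lemma near_power_density0 (w : nat -> nat) M K : (forall k, w k <= k)%N ->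
  exists N, forall n, (N <= n)%N -> (K * count_in (near_power w M) 0 n <= n)%N.
Proof.
move=> wk; have [N HN] := log_square_negligible K M; exists N => n /HN.
set L := trunc_log 2 _ => KL; apply: leq_trans KL; rewrite leq_mul//.
pose B k := [set x | (2 ^ k < x + M)%N /\ (x < 2 ^ k + w k + M)%N].
apply: (@leq_trans (\sum_(k < L.+1) (L + 2 * M))%N); last first.
  by rewrite sum_nat_const card_ord addn1.
apply: (@leq_trans (\sum_(k < L.+1) count_in (B k) 0 n)%N).
  apply: (count_in_cover (B := B)) => x xn [k [kx xk]]; exists k => //.
  by rewrite ltnS trunc_log_max//; lia.
apply: leq_sum => -[k /= kL] _; apply: (@count_in_interval _ _ _ (2 ^ k - M)%N).
by move=> x xn [kx xk]; have := wk k; lia.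
Qed.

(** The interval may lie far out, but powers beyond 2^L are at least 2^(L+1) > n - m + 2M apart, so
    at most one of their windows meets it. The small powers are counted one by one. *)
Lemma near_power_banach_density0 M K :
  exists N, forall m n, (m + N <= n)%N ->
    (K * count_in (near_power (fun=> 0) M) m n <= n - m)%N.
Proof.
have [N HN] := log_square_negligible (2 * K) M; exists N => m n mn.
have /HN : (N <= n - m)%N by lia.
set L := trunc_log 2 _ => KL; apply: leq_trans KL.
rewrite -mulnA mulnCA leq_mul//.
have Ln : (n - m + 2 * M < 2 ^ L.+1)%N by apply: trunc_log_ltn.
pose B k := [set x | (2 ^ k < x + M)%N /\ (x < 2 ^ k + M)%N].
(* The index L + 1 collects the windows of all large powers. *)
pose C k := if (k < L.+1)%N then B k else [set x | exists2 l, (L < l)%N & B l x].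
apply: (@leq_trans (\sum_(k < L.+2) (2 * M))%N); last first.
  by rewrite sum_nat_const card_ord; nia.
apply: (@leq_trans (\sum_(k < L.+2) count_in (C k) m n)%N).
  apply: (count_in_cover (B := C)) => x xn [k []]; rewrite addn0 => kx xk.
  have [kL|Lk] := ltnP k L.+1; first by exists k; [lia|rewrite /C kL].
  by exists L.+1 => //; rewrite /C ltnn; exists k.
apply: leq_sum => -[k /= kL] _; rewrite /C; case: ifPn => _.
  apply: (@count_in_interval _ _ _ (2 ^ k - M)%N).
  by move=> x xn [kx xk]; lia.
have [[y yn [l Ll [ly yl]]]|none] :=
    pselect (exists2 y, (m <= y < n)%N & exists2 l, (L < l)%N & B l y); last first.
  apply: (@count_in_interval _ _ _ 0%N) => x xn Cx; exfalso.
  by apply: none; exists x.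
have gap a b : (L < a)%N -> (a < b)%N -> (2 ^ a + 2 ^ L.+1 <= 2 ^ b)%N.
  move=> La ab; have : (2 ^ a.+1 <= 2 ^ b)%N by rewrite leq_exp2l.
  have : (2 ^ L.+1 <= 2 ^ a)%N by rewrite leq_exp2l.
  by rewrite !expnS; lia.
apply: (@count_in_interval _ _ _ (2 ^ l - M)%N) => x xn [j Lj [jx xj]].
have [jl|lj|jl] := ltngtP j l; last by subst; lia.
- by have := gap _ _ Lj jl; lia.
- by have := gap _ _ Ll lj; lia.
Qed.

Lemma not_farP (P : set nat) M n : ~ far P M n ->
  exists2 m, P m & (n < m + M)%N /\ (m < n + M)%N.
Proof.
by move=> /existsNP[m /not_implyP[Pm /not_orP[nm mn]]]; exists m => //; lia.
Qed.

Lemma far_power (w : nat -> nat) (P : set nat) M :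
  (forall m, P m -> exists k, (2 ^ k <= m <= 2 ^ k + w k)%N) ->
  ~` far P M `<=` near_power w M.
Proof.
by move=> Pw n /not_farP[m /Pw[k mk] [nm mn]]; exists k; split; lia.
Qed.

(* The intervals have period 8^(k+1) and length 2^k; starting them in the middle
   of each period keeps them away from 0 and from the sums of powers of 8. *)
Definition periodic_blocks : set nat :=
  [set n | exists k, (4 * 8 ^ k <= n %% 8 ^ k.+1 < 4 * 8 ^ k + 2 ^ k)%N].

Lemma sum_geometric_le (f : nat -> nat) n K :
  (forall k, f k * 2 ^ k.+1 <= n)%N -> (\sum_(k < K) f k <= n)%N.
Proof.
(* This is the bound n (1 - 2^-K) on the sum, cleared of denominators. *)
move=> fn; have : (2 ^ K * \sum_(k < K) f k + n <= n * 2 ^ K)%N.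
  elim: K => [|K IH]; first by rewrite big_ord0 expn0 muln0 muln1.
  rewrite big_ord_recr/=; have := fn K; rewrite (expnS 2 K).
  move: (\sum_(k < K) f k)%N (2 ^ K)%N (f K) IH => S E x; nia.
have : (0 < 2 ^ K)%N by rewrite expn_gt0.
move: (\sum_(k < K) f k)%N (2 ^ K)%N => S E; nia.
Qed.

(** If J bounds the number of level-k blocks starting below n, then 4 J 8^k <= n, so twice the
    level-k count is at most n / 2^(k+1). Summing over the levels gives n. *)
Lemma periodic_blocks_count n : (2 * count_in periodic_blocks 0 n <= n)%N.
Proof.
pose B k := [set x | (4 * 8 ^ k <= x %% 8 ^ k.+1 < 4 * 8 ^ k + 2 ^ k)%N].
apply: (@leq_trans (\sum_(k < n) 2 * count_in (B k) 0 n)%N).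
  rewrite -big_distrr/= leq_mul//; apply: (count_in_cover (B := B)) => x xn [k kx].
  exists k => //; apply: leq_trans (_ : x < n)%N; last by lia.
  rewrite ltnS; apply: leq_trans (leq_mod x (8 ^ k.+1)).
  have : (k < 8 ^ k)%N by apply: ltn_expl.
  by lia.
apply: (@sum_geometric_le (fun k => 2 * count_in (B k) 0 n)%N) => k.
(* A block starts at jc + 4 * 8^k, half a period in, so a start below n means (j + 1)c < n + 4 *
   8^k. *)
pose c := (8 ^ k.+1)%N; pose J := ((n + 4 * 8 ^ k) %/ c)%N.
have c8 : (c = 8 * 8 ^ k)%N by rewrite /c expnS.
have k0 : (0 < 8 ^ k)%N by rewrite expn_gt0.
have : (count_in (B k) 0 n <= \sum_(j < J) 2 ^ k)%N.
  apply: (@leq_trans (\sum_(j < J) count_in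
      [set x | (j * c + 4 * 8 ^ k <= x < j * c + 4 * 8 ^ k + 2 ^ k)%N] 0 n)%N).
    apply: (@count_in_cover _ (fun j =>
      [set x | (j * c + 4 * 8 ^ k <= x < j * c + 4 * 8 ^ k + 2 ^ k)%N])).
    move=> x xn Bx; have xE := divn_eq x c; exists (x %/ c)%N; last first.
      by move: Bx; rewrite /B/= -/c; lia.
    by rewrite /J leq_divRL; [move: Bx; rewrite /B/= -/c; lia|lia].
  by apply: leq_sum => j _; apply: (@count_in_interval _ _ _ (j * c + 4 * 8 ^ k)%N).
rewrite sum_nat_const card_ord => cB.
have Jn : (J * 8 ^ k * 4 <= n)%N.
  have Jc : (J * c <= n + 4 * 8 ^ k)%N by apply: leq_divM.
  have [->//|J0] := posnP J.
  by move: Jc; rewrite c8; nia.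
have : (2 ^ k * 2 ^ k <= 8 ^ k)%N by rewrite -expnMn; case: (k) => // j; rewrite leq_exp2r.
rewrite expnS; nia.
Qed.

(** * IP-sets *)

(* The naturals whose digits in base 8 are all 0 or 1. *)
Definition binary_octal : set nat :=
  [set n | forall k, (n %% 8 ^ k.+1 < 2 * 8 ^ k)%N].

(** Modulo 8^(k+1) only exponents up to k survive, and the sum of all those powers is below 2 *
    8^k. *)
Lemma finite_sums_binary_octal : finite_sums (expn 8) `<=` binary_octal.
Proof.
move=> n [r /andP[_ rs] ->] k; rewrite (bigID (fun i => (i <= k)%N))/=.
rewrite -modnDmr (_ : (\sum_(i <- r | ~~ (i <= k)) 8 ^ i) %% _ = 0)%N; last first.
  apply/eqP; apply: dvdn_sum => i; rewrite -ltnNge => ki.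
  exact: dvdn_exp2l.
rewrite addn0; apply: leq_ltn_trans (leq_mod _ _) _.
have geo : (\sum_(i <- iota 0 k.+1) 8 ^ i < 2 * 8 ^ k)%N.
  rewrite -[iota _ _]/(index_iota 0 k.+1).
  elim: (k) => [|j IH]; first by rewrite big_nat1.
  by rewrite big_nat_recr//= expnS; lia.
apply: leq_ltn_trans geo; rewrite -[leqLHS]big_filter.
apply: (uniq_sub_le_big leqnn (fun m n => leq_addr n m)).
- by rewrite filter_uniq// (sorted_uniq ltn_trans ltnn).
- exact: iota_uniq.
by move=> i; rewrite mem_filter mem_iota => /andP[ik _].
Qed.

Lemma F_ip_finite_sums_exp8 : F_ip (finite_sums (expn 8)).
Proof.
exists (expn 8) => //; rewrite (_ : [set n | _] = setT); first exact: infinite_nat.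
by apply/seteqP; split => // n _; apply/eqP; rewrite expn_eq0.
Qed.

Section finite_sums.
Variable x : nat -> nat.

(** Recording the index range lets sums over successive ranges be added while remaining finite sums
    of [x]. *)
Definition sums_in a b : set nat := [set n | exists r,
  [/\ r != [::], sorted ltn r, all (fun i => (a <= i < b)%N) r &
     n = (\sum_(i <- r) x i)%N]].

Lemma sums_in_finite_sums a b : sums_in a b `<=` finite_sums x.
Proof. by move=> n [r [r0 rs _ ->]]; exists r => //; rewrite r0. Qed.

Lemma sums_inD a b c d m n : (b <= c)%N -> sums_in a b m -> sums_in c d n ->
  sums_in a d (m + n)%N.
Proof.
move=> bc [r [r0 rs rb ->]] [t [t0 ts tc ->]]; exists (r ++ t).
have lt_trans := ltn_trans.
split; last by rewrite big_cat.
- by case: (r) r0.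
- move: rs ts; rewrite !(sorted_pairwise ltn_trans) pairwise_cat => -> ->.
  rewrite !andbT; apply/allrelP => i j /(allP rb) ? /(allP tc) ?; lia.
- rewrite all_cat; apply/andP; split.
  + case: t t0 tc {ts} => // j t _ /= /andP[jc _].
    by apply/allP => i /(allP rb); lia.
  + case: r r0 rb {rs} => // j r _ /= /andP[jc _].
    by apply/allP => i /(allP tc); lia.
Qed.

Hypothesis x_inf : infinite_set [set n | x n <> 0%N].

(** Past any index there is a further non-zero term, and it raises the sum by at least 1. *)
Lemma sums_in_large C a : exists b n, (C <= n)%N /\ sums_in a b n.
Proof.
elim: C => [|C [b [n [Cn an]]]].
  exists a.+1, (x a); split => //; exists [:: a].
  by rewrite big_seq1/= leqnn ltnSn; split.
have [i bi xi] : exists2 i, (b <= i)%N & x i <> 0%N.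
  apply: contrapT => none; apply: x_inf; apply: (sub_finite_set _ (finite_II b)).
  move=> i /= xi; rewrite ltnNge; apply/negP => bi; apply: none.
  by exists i.
exists i.+1, (n + x i)%N; split; first by lia.
apply: sums_inD an _; first exact: bi.
by exists [:: i]; rewrite big_seq1/= leqnn ltnSn; split.
Qed.

End finite_sums.

Definition power_differences : set nat := difference_set (range (expn 4)).

Lemma power_differenceP d : power_differences d ->
  exists i j, (4 * 4 ^ j <= 4 ^ i)%N /\ (d + 4 ^ j = 4 ^ i)%N.
Proof.
move=> [_ [_ [[i _ <-] [j _ <-] ij dE]]]; exists i, j.
have {}dE : (d + 4 ^ j = 4 ^ i)%N by lia.
split => //; rewrite -expnS leq_exp2l// ltnNge; apply/negP => ji.
have : (4 ^ i <= 4 ^ j)%N by rewrite leq_exp2l.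
lia.
Qed.

(** Turns the spacing of the powers of 4 into linear facts, on which [lia] works once the powers are
    generalized. *)
Lemma exp4_gap i j :
  (4 ^ i = 4 ^ j \/ 4 * 4 ^ i <= 4 ^ j \/ 4 * 4 ^ j <= 4 ^ i)%N.
Proof.
have [ij|ji|->] := ltngtP i j.
- by right; left; rewrite -expnS leq_exp2l.
- by right; right; rewrite -expnS leq_exp2l.
- by left.
Qed.

(* If c and a + c are both close to differences of powers of 4, then for c large
   the two leading powers agree, and the subtracted ones are bounded by a. *)
Lemma near_power_difference M a c : (2 * M < a)%N -> (10 * (a + M) < c)%N ->
  ~ far power_differences M c -> ~ far power_differences M (a + c) ->
  exists i, (c <= 4 ^ i + (2 * a + 5 * M) /\ 4 ^ i <= c + (2 * a + 5 * M))%N.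
Proof.
move=> Ma ac /not_farP[d /power_differenceP[i [j [ji dE]]] [cd dc]].
move=> /not_farP[e /power_differenceP[k [l [lk eE]]] [ce ec]].
exists i; have := exp4_gap j l; have := exp4_gap i k.
move: (4 ^ i)%N (4 ^ j)%N (4 ^ k)%N (4 ^ l)%N ji dE lk eE => I J K L *.
by split; lia.
Qed.

(** Otherwise all finite sums are near differences of powers of 4. For a, b, c from successive index
    ranges, each much larger than the previous, c and b + c are then both within R of powers of 4,
    where R depends only on a and M. *)
Lemma far_power_differences M : star F_ip (far power_differences M).
Proof.
move=> B [x x_inf xB]; apply: contrapT => none.
have near n : finite_sums x n -> ~ far power_differences M n.
  by move=> xn nfar; apply: none; exists n; split => //; exact: xB.
have [b0 [a [aM xa]]] := sums_in_large x_inf (2 * M).+1 0.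
pose R := (2 * a + 5 * M)%N.
have [b1 [b [bR xb]]] := sums_in_large x_inf (2 * R).+1 b0.
have [b2 [c [cR xc]]] := sums_in_large x_inf (10 * (a + b + M + R)).+1 b1.
have xbc := sums_inD (leqnn _) xb xc.
have b01 : (b0 <= b1)%N.
  have [[|i r] [//_ _ + _]] := xb; rewrite /=; lia.
have [] := @near_power_difference M a c aM.
- lia.
- exact/near/(sums_in_finite_sums xc).
- exact/near/sums_in_finite_sums/(sums_inD b01 xa xc).
move=> i [ci ic].
have [] := @near_power_difference M a (b + c) aM.
- lia.
- exact/near/(sums_in_finite_sums xbc).
- exact/near/sums_in_finite_sums/(sums_inD (leqnn _) xa xbc).
(* Equal powers would give b <= 2R; distinct ones differ by a factor of 4, too much since c
   dominates b and R. *)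
move=> k [bck kbc]; have := exp4_gap i k; rewrite -/R in ci ic bck kbc.
move: (4 ^ i)%N (4 ^ k)%N ci ic bck kbc => I K *; lia.
Qed.

Lemma binary_octal_div n : binary_octal n ->
  (n %% 8 < 2)%N /\ binary_octal (n %/ 8)%N.
Proof.
move=> nb; split; first exact: (nb 0%N).
move=> k; rewrite modn_divl -expnSr ltn_divLR//.
by apply: leq_trans (nb k.+1) _; rewrite [(8 ^ k.+1)%N]expnSr mulnA.
Qed.

(* An approximate arithmetic progression s, t, u in binary_octal has bounded
   gaps: s + u and 2 t have digits 0, 1, 2 and 0, 2, so no carry occurs. *)
Lemma binary_octal_progression K s t u :
  binary_octal s -> binary_octal t -> binary_octal u ->
  (s + u <= 2 * t + K)%N -> (2 * t <= s + u + K)%N ->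
  (u < t + 9 ^ K)%N /\ (t < u + 9 ^ K)%N.
Proof.
elim: K s t u => [|K IH] s t u bs bt bu.
  rewrite !addn0 expn0 => h1 h2; suff : t = u by lia.
  have {h1 h2} : (s + u = 2 * t)%N by lia.
  have [m] := ubnP (s + t + u)%N.
  elim: m => // m IH in s t u bs bt bu *; rewrite ltnS => stu sut.
  have [s2 bs'] := binary_octal_div bs.
  have [t2 bt'] := binary_octal_div bt.
  have [u2 bu'] := binary_octal_div bu.
  have [|stu0] := posnP (s + t + u)%N; first by lia.
  have tu : (t %/ 8 = u %/ 8)%N by apply: (IH (s %/ 8)%N) => //; lia.
  by lia.
move=> h1 h2.
have [s2 bs'] := binary_octal_div bs.
have [t2 bt'] := binary_octal_div bt.
have [u2 bu'] := binary_octal_div bu.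
(* Dropping the last digits leaves an error of at most (K + 3) / 8, hence at most K once rounded
   down. Restoring them turns the gap bound 9^K into at most 9^(K+1). *)
have [||] := IH _ _ _ bs' bt' bu'; [lia|lia|].
rewrite expnS; move: (9 ^ K)%N => N; lia.
Qed.

(** For p, r, q from successive index ranges, q - p - r, q - r and q + p - r are differences of
    finite sums and form a progression of step p. Were all within M of [binary_octal], the
    approximants would be a progression up to 4M with a gap exceeding 9^(4M). *)
Lemma far_binary_octal M : star Delta_ip (far binary_octal M).
Proof.
move=> _ [F [x x_inf xF] <-]; apply: contrapT => none.
have near d m n : finite_sums x m -> finite_sums x n -> (d + n = m)%N -> (0 < d)%N ->
    exists2 q, binary_octal q & (d < q + M)%N /\ (q < d + M)%N.
  move=> xm xn dm d0; apply: not_farP => dfar; apply: none; exists d; split => //.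
  by exists m, n; split; [exact: xF|exact: xF|lia|lia].
have [b0 [p [pM xp]]] := sums_in_large x_inf (9 ^ (4 * M) + 2 * M).+1 0.
have [b1 [r [_ xr]]] := sums_in_large x_inf 0 b0.
have [b2 [q [qpr xq]]] := sums_in_large x_inf (p + r).+1 b1.
have b01 : (b0 <= b1)%N.
  have [[|i t] [//_ _ + _]] := xr; rewrite /=; lia.
have [] := near (q - (p + r))%N q (p + r)%N (sums_in_finite_sums xq)
  (sums_in_finite_sums (sums_inD (leqnn _) xp xr)); [lia|lia|].
move=> s bs [sq qs].
have [] := near (q - r)%N q r (sums_in_finite_sums xq) (sums_in_finite_sums xr);
  [lia|lia|].
move=> t bt [tq qt].
have [] := near (p + q - r)%N (p + q)%N r
  (sums_in_finite_sums (sums_inD b01 xp xq)) (sums_in_finite_sums xr); [lia|lia|].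
move=> u bu [uq qu].
have [] := @binary_octal_progression (4 * M) s t u bs bt bu; lia.
Qed.

(** * Gaps and densities of the chosen sets *)

(** A block of level 2M is longer than 2M, so the point M after its start is M-far from the
    complement. Such points recur with period c; taking the next period keeps the witness above
    n. *)
Lemma far_not_periodic_blocks M : syndetic (far (~` periodic_blocks) M).
Proof.
pose k := (2 * M)%N; pose c := (8 ^ k.+1)%N.
have c8 : c = (8 * 8 ^ k)%N by rewrite /c expnS.
have k2 : (k < 2 ^ k)%N by apply: ltn_expl.
have k8 : (2 ^ k <= 8 ^ k)%N by case: (k) => // j; rewrite leq_exp2r.
exists (2 * c)%N => n; exists ((n %/ c).+1 * c + (4 * 8 ^ k + M))%N.
  by have := divn_eq n c; have := @ltn_pmod n c; rewrite mulSn; lia.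
move=> m mP; apply: contrapT => /not_orP[mq qm]; apply: mP; exists k.
have [l mE lM] : exists2 l, m = ((n %/ c).+1 * c + l)%N &
    (4 * 8 ^ k <= l < 4 * 8 ^ k + 2 ^ k)%N.
  by exists (m - (n %/ c).+1 * c)%N; lia.
by rewrite -/c mE modnMDl modn_small//; lia.
Qed.

Lemma binary_octal_not_periodic_blocks : binary_octal `<=` ~` periodic_blocks.
Proof. by move=> n nb [k]; have := nb k; lia. Qed.

Lemma upper_density_eq0 (R : realType) (A : set nat) :
  (forall K, exists N, forall n, (N <= n)%N -> (K * count_in A 0 n <= n)%N) ->
  (upper_density R A <= 0)%E.
Proof.
move=> AK; apply/lee_addgt0Pr => e e0; rewrite add0e.
have [N HN] := AK (Num.bound e^-1).
apply: (@upper_density_le_eventually _ _ _ N) => [n /HN|]; last exact: ltW.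
rewrite -(ler_nat R) natrM => /(le_trans _) h.
have eb : e^-1 <= (Num.bound e^-1)%:R.
  by rewrite ltW// archi_boundP// invr_ge0 ltW.
by rewrite -ler_pdivrMl// h// ler_wpM2r.
Qed.

Definition long_blocks : set nat := [set n | exists k, (2 ^ k <= n < 2 ^ k + k)%N].

Lemma count_in_subset_negligible (A B : set nat) : A `<=` B ->
  (forall K, exists N, forall n, (N <= n)%N -> (K * count_in B 0 n <= n)%N) ->
  forall K, exists N, forall n, (N <= n)%N -> (K * count_in A 0 n <= n)%N.
Proof.
move=> AB BK K; have [N HN] := BK K; exists N => n /HN; apply: leq_trans.
by rewrite leq_mul// count_in_le.
Qed.

Lemma long_blocks_upper_density (R : realType) :
  (upper_density R long_blocks <= 0)%E.
Proof.
apply/upper_density_eq0/(@count_in_subset_negligible _ (near_power id 1)).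
  by move=> n [k nk]; exists k; split; lia.
by move=> K; apply: near_power_density0.
Qed.

Lemma far_not_long_blocks M : far (~` long_blocks) M !=set0.
Proof.
(* The midpoint of the block of length 2M. *)
exists (2 ^ (2 * M) + M)%N => m mP; apply: contrapT => /not_orP[mq qm].
by apply: mP; exists (2 * M)%N; lia.
Qed.

Lemma far_long_blocks (R : realType) M : F_ld1 R (far long_blocks M).
Proof.
apply/lower_density1/(@count_in_subset_negligible _ (near_power id M)).
  by apply: far_power => m [k mk]; exists k; lia.
by move=> K; apply: near_power_density0.
Qed.

Lemma not_syndetic_not_long_blocks : ~ syndetic (~` long_blocks).
Proof.
(* The window from 2^(M+1) has M + 1 points and fills exactly one block. *)
move=> [M /(_ (2 ^ M.+1)%N)[k kM]]; apply; exists M.+1; lia.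
Qed.

Lemma far_range_exp2 (R : realType) M : F_lbd1 R (far (range (expn 2)) M).
Proof.
apply: lower_banach_density1 => K.
have [N HN] := near_power_banach_density0 M K; exists N => m n /HN.
apply: leq_trans; rewrite leq_mul//; apply: count_in_le; apply: far_power.
by move=> _ [k _ <-]; exists k; lia.
Qed.

Lemma infinite_range_expn b : (1 < b)%N -> infinite_set (range (expn b)).
Proof.
move=> b1; rewrite (eq_finite_set (inj_card_eq _)); first exact: infinite_nat.
by move=> n m _ _ /eqP; rewrite eqn_exp2l// => /eqP.
Qed.

Theorem proposition4p15 (R : realType) (s : scalars) (i : space_index R) :
  (exists T : {linear sequence_space s i -> sequence_space s i},
     [/\ invertible_operator T, weakly_mixing T &
         ~ family_transitive (F_pud R) T]) /\
  (exists T : {linear sequence_space s i -> sequence_space s i},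
     [/\ invertible_operator T, topologically_ergodic T &
         ~ family_transitive (star F_ip) T]) /\
  (exists T : {linear sequence_space s i -> sequence_space s i},
     [/\ invertible_operator T, topologically_ergodic T &
         ~ family_transitive (F_ud1 R) T]) /\
  (exists T : {linear sequence_space s i -> sequence_space s i},
     [/\ invertible_operator T, family_transitive (F_ld1 R) T &
         ~ topologically_ergodic T]) /\
  (exists T : {linear sequence_space s i -> sequence_space s i},
     [/\ invertible_operator T, family_transitive (F_lbd1 R) T &
         ~ strongly_mixing T]) /\
  (exists T : {linear sequence_space s i -> sequence_space s i},
     [/\ invertible_operator T, family_transitive (star F_ip) T &
         ~ family_transitive (star Delta) T]) /\
  (exists T : {linear sequence_space s i -> sequence_space s i},
     [/\ invertible_operator T, family_transitive (star Delta_ip) T &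
         ~ family_transitive (star F_ip) T]).
Proof.
have blocks0 : ~` periodic_blocks !=set0.
  exists 0%N => -[k]; rewrite mod0n.
  by have : (0 < 8 ^ k)%N by [rewrite expn_gt0]; lia.
(* Serves items (2) and (7): P contains the IP-set of finite sums of powers of 8, which its
   complement therefore misses. *)
have not_star_ip (P : set nat) : binary_octal `<=` P -> ~ star F_ip (~` P).
  move=> bP /(_ _ F_ip_finite_sums_exp8)[n [nP /finite_sums_binary_octal]].
  by move/bP.
split; [|split; [|split; [|split; [|split; [|split]]]]].
- have P0 : ~` long_blocks !=set0.
    by exists 0%N => -[k]; have : (0 < 2 ^ k)%N by [rewrite expn_gt0]; lia.
  have [T [Tinv Tmix _ nT]] := exists_operator s i P0.
  exists T; split => //; first by apply: Tmix => M; exact: far_not_long_blocks.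
  apply: nT (@F_pud_upward R) _; rewrite setCK /F_pud/=.
  by apply/negP; rewrite -leNgt long_blocks_upper_density.
- have [T [Tinv _ TF nT]] := exists_operator s i blocks0.
  exists T; split => //.
    by apply: TF syndetic_upward _ => M; exact: far_not_periodic_blocks.
  apply: nT (@star_upward F_ip) _.
  exact/not_star_ip/binary_octal_not_periodic_blocks.
- have [T [Tinv _ TF nT]] := exists_operator s i blocks0.
  exists T; split => //.
    by apply: TF syndetic_upward _ => M; exact: far_not_periodic_blocks.
  apply: nT (@F_ud1_upward R) _; rewrite setCK /F_ud1/= => ud1.
  have : (upper_density R periodic_blocks <= (2^-1)%:E)%E.
    apply: (@upper_density_le_eventually _ _ _ 0) => [n _|]; last by rewrite invr_ge0.
    by rewrite ler_pdivlMl// -natrM ler_nat periodic_blocks_count.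
  by apply/negP; rewrite ud1 -ltNge lte_fin invf_lt1// ltr1n.
- have P0 : long_blocks !=set0 by exists 2%N; exists 1%N.
  have [T [Tinv _ TF nT]] := exists_operator s i P0.
  exists T; split => //.
    by apply: TF (@F_ld1_upward R) _ => M; exact: far_long_blocks.
  exact: nT syndetic_upward not_syndetic_not_long_blocks.
- have P0 : range (expn 2) !=set0 by exists 1%N; exists 0%N.
  have [T [Tinv _ TF nT]] := exists_operator s i P0.
  exists T; split => //.
    by apply: TF (@F_lbd1_upward R) _ => M; exact: far_range_exp2.
  apply: nT cofinite_upward _; rewrite /= setCK.
  exact: infinite_range_expn.
- have P0 : power_differences !=set0.
    by exists 3%N, 4%N, 1%N; split => //; [exists 1%N|exists 0%N].
  have [T [Tinv _ TF nT]] := exists_operator s i P0.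
  exists T; split => //.
    by apply: TF (@star_upward F_ip) _ => M; exact: far_power_differences.
  apply: nT (@star_upward Delta) _ => /(_ power_differences)[].
    by exists (range (expn 4)) => //; exact: infinite_range_expn.
  by move=> n [].
have P0 : binary_octal !=set0.
  by exists 0%N => k; rewrite mod0n muln_gt0 expn_gt0.
have [T [Tinv _ TF nT]] := exists_operator s i P0.
exists T; split => //.
  by apply: TF (@star_upward Delta_ip) _ => M; exact: far_binary_octal.
exact: nT (@star_upward F_ip) (not_star_ip _ _).
Qed.
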